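(* Let $G$ be a connected very well-covered graph with $2n\geq 4$ vertices, $K$ a field and $S=K[x_v : v\in V(G)]$. The following are equivalent: (i) $S/NI(G)$ is Cohen–Macaulay; (ii) $G$ is well-dominated; (iii) $G=C_4$ or $G$ is a whisker graph; (iv) $G=C_4$ or $NI(G)$ is a complete intersection; (v) $G=C_4$ or $S/NI(G)$ is Gorenstein; (vi) $\gamma(G)=\alpha(G)=n$.
   Context: $G$ is very well-covered if it has no isolated vertices and every maximal independent set has exactly $|V(G)|/2$ elements. $N_G[v]$ is the closed neighborhood of $v$ and $NI(G)=\big(\prod_{w\in N_G[v]} x_w : v\in V(G)\big)$ is the closed neighborhood ideal. A dominating set is a set $D\subseteq V(G)$ with $D\cap N_G[v]\neq\emptyset$ for all $v$; $\gamma(G)$ is the minimum size of a dominating set; $G$ is well-dominated if all minimal dominating sets have the same cardinality. $\alpha(G)$ is the independence number. A whisker graph is a graph in which every vertex either has degree one or has a unique neighbor of degree one. $C_4$ is the $4$-cycle. $K$ is an infinite field. *)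

(* Defs.v *)
From HB Require Import structures.
From mathcomp Require Import all_boot all_order all_algebra.
From mathcomp Require Import mpoly.
Set Implicit Arguments. Unset Strict Implicit. Unset Printing Implicit Defensive.
Import GRing.Theory.
Local Open Scope ring_scope.

Section CommAlg.
Variable R : comPzRingType.

Definition ideal_of (gs : seq R) : R -> Prop :=
  fun p => exists cs : seq R, p = \sum_(i < size gs) cs`_i * gs`_i.

Definition zero_ideal : R -> Prop := fun p => p = 0.

Definition iadd (I J : R -> Prop) : R -> Prop :=
  fun p => exists a b, I a /\ J b /\ p = a + b.

Definition is_ideal (I : R -> Prop) : Prop :=
  [/\ I 0, (forall a b, I a -> I b -> I (a + b)) & (forall r a, I a -> I (r * a))].

Definition prime_ideal (P : R -> Prop) : Prop :=
  [/\ is_ideal P, ~ P 1 & (forall a b, P (a * b) -> P a \/ P b)].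

Definition nzd_mod (J : R -> Prop) (f : R) : Prop :=
  forall g, J (f * g) -> J g.

Definition regular_seq (I : R -> Prop) (fs : seq R) : Prop :=
  (forall i, (i < size fs)%N -> nzd_mod (iadd I (ideal_of (take i fs))) fs`_i)
  /\ ~ iadd I (ideal_of fs) 1.

Definition seq_in (M : R -> Prop) (fs : seq R) : Prop :=
  forall i, (i < size fs)%N -> M fs`_i.

Definition depth_is (I M : R -> Prop) (d : nat) : Prop :=
  (exists fs, size fs = d /\ seq_in M fs /\ regular_seq I fs)
  /\ (forall fs, seq_in M fs -> regular_seq I fs -> (size fs <= d)%N).

Definition prime_chain (I : R -> Prop) (Ps : nat -> R -> Prop) (d : nat) : Prop :=
  (forall i, (i <= d)%N -> prime_ideal (Ps i) /\ (forall a, I a -> Ps i a))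
  /\ (forall i, (i < d)%N ->
        (forall a, Ps i a -> Ps i.+1 a) /\ exists a, Ps i.+1 a /\ ~ Ps i a).

Definition dim_is (I : R -> Prop) (d : nat) : Prop :=
  (exists Ps, prime_chain I Ps d) /\ (forall Ps, ~ prime_chain I Ps d.+1).

(* R/I is Cohen-Macaulay (graded setting: depth w.r.t. the homogeneous
   maximal ideal M equals the Krull dimension) *)
Definition cohen_macaulay (I M : R -> Prop) : Prop :=
  exists d, depth_is I M d /\ dim_is I d.

Definition complete_intersection (I : R -> Prop) : Prop :=
  exists fs, (forall p, I p <-> ideal_of fs p) /\ regular_seq zero_ideal fs.

End CommAlg.

(* R/I Gorenstein: Cohen-Macaulay of type 1, i.e. modulo a maximal
   R/I-regular sequence in M the socle (0 :_{R/J} M) is a one-dimensional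
   K-vector space. *)
Definition socle_dim1 (K : fieldType) (R : comAlgType K) (J M : R -> Prop) : Prop :=
  exists g, [/\ ~ J g, (forall x, M x -> J (x * g)) &
    (forall h, (forall x, M x -> J (x * h)) -> exists c : K, J (h - c *: g))].

Definition gorenstein (K : fieldType) (R : comAlgType K) (I M : R -> Prop) : Prop :=
  exists d fs, [/\ dim_is I d, depth_is I M d, size fs = d, seq_in M fs &
    regular_seq I fs /\ socle_dim1 (iadd I (ideal_of fs)) M].

Section Graphs.
Variables (T : finType) (e : rel T).

Definition simple_graph : Prop := ssrbool.symmetric e /\ irreflexive e.
Definition connected_graph : Prop := forall x y, connect e x y.

Definition cnbhd (v : T) : {set T} := [set w | (w == v) || e v w].
Definition deg (v : T) : nat := #|[set w | e v w]|.

Definition independent (S : {set T}) : bool :=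
  [forall x in S, forall y in S, ~~ e x y].
Definition maximal_independent (S : {set T}) : bool :=
  independent S && [forall x, (x \notin S) ==> ~~ independent (x |: S)].

Definition dominating (D : {set T}) : bool :=
  [forall v, D :&: cnbhd v != set0].
Definition minimal_dominating (D : {set T}) : bool :=
  dominating D && [forall x in D, ~~ dominating (D :\ x)].

Definition gamma : nat := \big[minn/#|T|]_(D : {set T} | dominating D) #|D|.
Definition alpha : nat := \max_(S : {set T} | independent S) #|S|.

Definition well_dominated : Prop :=
  forall D1 D2, minimal_dominating D1 -> minimal_dominating D2 -> #|D1| = #|D2|.

Definition very_well_covered : Prop :=
  (forall v, exists w, e v w) /\
  (forall S, maximal_independent S -> (#|S| * 2)%N = #|T|).

Definition whisker_graph : Prop :=
  forall v, deg v = 1%N \/ #|[set w | e v w & deg w == 1%N]| = 1%N.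

Definition C4_adj (i j : 'I_4) : bool :=
  (j == (i.+1 %% 4)%N :> nat) || (i == (j.+1 %% 4)%N :> nat).
Definition is_C4 : Prop :=
  exists f : T -> 'I_4, bijective f /\ forall u v, e u v = C4_adj (f u) (f v).

Variable K : fieldType.
Definition xv (v : T) : {mpoly K[#|T|]} := 'X_(enum_rank v).

Definition NI : {mpoly K[#|T|]} -> Prop :=
  ideal_of [seq \prod_(w in cnbhd v) xv w | v <- enum T].

Definition hmax : {mpoly K[#|T|]} -> Prop := ideal_of [seq xv v | v <- enum T].

End Graphs.

(* Main.v *)
(** Very well-covered graphs: a maximal independent set A and its complement
    are both dominating sets of size n. If gamma(G) = n, the complement is
    minimal, so each of its elements has a private closed neighbor; a vertex
    that is neither a leaf nor adjacent to one therefore has only neighbors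
    that are twins of each other, which forces G = C_4.

    Algebra: the minimal primes of NI(G) are generated by the minimal dominating
    sets D, and they are annihilators P_D = (NI : g), g the product of the x_v
    with v outside D. If f is a regular sequence of length d modulo NI, so are the
    powers f^k, and for large k the monomial g is not in NI + (f^k). If d exceeded
    2n - |D|, the f^k would be algebraically dependent modulo P_D, i.e.
    g F(f^k) in NI for some F <> 0; dividing by the lowest power of each
    f_i^k in turn puts g into NI + (f^k), a contradiction. Thus
    depth <= 2n - |D| for every D, and since dim >= 2n - |D|, Cohen-Macaulay forces
    well-dominated. The same peeling of an algebraic relation bounds the length
    of chains of primes. A complete intersection is well-dominated because
    I/I^2 is free and agrees with P_D/P_D^2 near a general point of V(P_D).
    Conversely, for whiskers x_i y_i the sequence x_i - y_i is regular with quotient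
    K[x]/(x_i^2), and for C_4 the first two elementary symmetric polynomials
    form a regular sequence. *)

Require Import Defs.
From HB Require Import structures.
From mathcomp Require Import all_boot all_order all_algebra.
From mathcomp Require Import mpoly ring zify.
Set Implicit Arguments.
Unset Strict Implicit.
Unset Printing Implicit Defensive.
Import GRing.Theory.

(** * Graphs with domination number half the order *)

Lemma dominatingPn (T : finType) (e : rel T) (D : {set T}) :
  ~~ dominating e D -> exists v, cnbhd e v \subset ~: D.
Proof.
move=> /forallPn[v]; rewrite negbK setIC => /eqP H; exists v.
by rewrite -disjoints_subset -setI_eq0 H.
Qed.

Section Combinatorics.
Variables (T : finType) (e : rel T) (n : nat).
Hypothesis e_sym : ssrbool.symmetric e.
Hypothesis e_irr : irreflexive e.
Hypothesis e_conn : connected_graph e.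
Hypothesis e_nbr : forall v, exists w, e v w.
Hypothesis e_vwc : forall A, maximal_independent e A -> (#|A| * 2)%N = #|T|.
Hypothesis cardT : #|T| = (2 * n)%N.
Hypothesis n_ge2 : (2 <= n)%N.
Implicit Types (A B D : {set T}) (u v w x y : T).

Lemma indepP A : reflect {in A &, forall x y, ~~ e x y} (independent e A).
Proof.
apply: (iffP forall_inP) => [H x y xA yA|H x xA].
  by have /forall_inP := H x xA; apply.
by apply/forall_inP => y; apply: H.
Qed.

Lemma extend_independent A : independent e A ->
  exists2 B, maximal_independent e B & A \subset B.
Proof.
move=> iA; have [B /maxsetP[iB maxB] AB] := maxset_exists iA.
exists B => //; rewrite /maximal_independent iB /=.
apply/forallP => x; apply/implyP; apply: contra => iU.
by rewrite -(maxB _ iU (subsetU1 x B)) setU11.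
Qed.

Lemma max_independent_card A : maximal_independent e A -> #|A| = n.
Proof. by move/e_vwc; rewrite cardT; lia. Qed.

Lemma max_independent_nbr A v : maximal_independent e A -> v \notin A ->
  exists2 w, w \in A & e v w.
Proof.
case/andP => /indepP iA /forallP /(_ v) /implyP H /H /negP nI.
apply/exists_inP; apply: contraT => /exists_inPn Hv; case: nI.
apply/indepP => x y; rewrite !inE => /predU1P[->|xA] /predU1P[->|yA].
- by rewrite e_irr.
- exact: Hv.
- by rewrite e_sym; apply: Hv.
- exact: iA.
Qed.

(** By maximality every outside vertex has a neighbor in [A]; by independence each vertex of [A] is
    its own private closed neighbor. *)
Lemma max_independent_dominating A : maximal_independent e A -> minimal_dominating e A.
Proof.
move=> mA; apply/andP; split.
  apply/forallP => v; apply/set0Pn; have [vA|nvA] := boolP (v \in A).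
    by exists v; rewrite !inE vA eqxx.
  by have [w wA vw] := max_independent_nbr mA nvA; exists w; rewrite !inE wA vw orbT.
have /andP[/indepP iA _] := mA; apply/forall_inP => v vA; apply/forallPn.
exists v; rewrite negbK; apply/eqP/setP => w; rewrite !inE.
have [->|_] //= := eqVneq w v; apply/negP => /andP[wA].
by rewrite (negbTE (iA v w vA wA)).
Qed.

Lemma alphaE : alpha e = n.
Proof.
apply/eqP; rewrite eqn_leq; apply/andP; split.
  apply/bigmax_leqP => A /extend_independent[B /max_independent_card <-].
  exact: subset_leq_card.
have [|A mA _] := @extend_independent set0.
  by apply/indepP => x y; rewrite inE.
have /andP[iA _] := mA; rewrite -(max_independent_card mA).
exact: (@leq_bigmax_cond _ (independent e) (fun A : {set T} => #|A|) A iA).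
Qed.

Lemma gamma_le D : dominating e D -> gamma e <= #|D|.
Proof.
rewrite /gamma; have : D \in index_enum {set T} by rewrite mem_index_enum.
elim: (index_enum _) => // B r IH; rewrite inE big_cons => /predU1P[<- ->|Dr dD].
  exact: geq_minl.
by case: ifP => _; rewrite ?geq_min ?IH ?orbT.
Qed.

Lemma gamma_witness : exists2 D, dominating e D & #|D| = gamma e.
Proof.
rewrite /gamma; elim/big_ind: _ => [|k l [D1 d1 <-] [D2 d2 <-]|D dD].
(* The default [#|T|] of the minimum is attained by the full vertex set. *)
- exists setT; last exact: cardsT.
  by apply/forallP => v; apply/set0Pn; exists v; rewrite !inE eqxx.
- by case: leqP => _; [exists D1|exists D2].
- by exists D.
Qed.

(** A dominating set of minimum size is minimal, and a maximal independent set is a minimal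
    dominating set of size [n]. *)
Lemma well_dominated_gamma : well_dominated e -> gamma e = alpha e /\ alpha e = n.
Proof.
move=> wd; rewrite alphaE; split=> //.
have [|A mA _] := @extend_independent set0.
  by apply/indepP => x y; rewrite inE.
have [D dD ED] := gamma_witness.
rewrite -(max_independent_card mA) -ED; apply: wd; last exact: max_independent_dominating.
apply/andP; split=> //; apply/forall_inP => v vD; apply/negP => /gamma_le.
by rewrite -ED (cardsD1 v D) vD add1n ltnn.
Qed.

(** * Leaves and the matching of a whisker graph *)

Definition leaf v := deg e v == 1%N.

Lemma leafP v : reflect (exists2 s, e v s & forall w, e v w -> w = s) (leaf v).
Proof.
apply: (iffP cards1P) => [[s E]|[s vs H]].
  exists s => [|w vw]; first by have := set11 s; rewrite -E inE.
  by apply/set1P; rewrite -E inE.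
by exists s; apply/setP => w; rewrite !inE; apply/idP/eqP => [/H|->].
Qed.

Lemma leaf_nbr v s w : leaf v -> e v s -> e v w -> w = s.
Proof. by case/leafP => t _ H /H -> /H. Qed.

Lemma nonleaf_nbr v u : ~~ leaf v -> e v u -> exists2 u', e v u' & u' != u.
Proof.
move=> nl vu; apply/exists_inP; apply: contraR nl => /exists_inPn H.
by apply/leafP; exists u => // w /H; rewrite negbK => /eqP.
Qed.

Lemma closed_all A v : v \in A -> (forall x y, x \in A -> e x y -> y \in A) ->
  forall w, w \in A.
Proof.
move=> vA HA w; rewrite -(closed_connect _ (e_conn v w)) // => x y xy.
by apply/idP/idP => H; [apply: HA H xy|apply: HA H _; rewrite e_sym].
Qed.

(** Two adjacent leaves would form a whole component, leaving only two vertices. *)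
Lemma leaf_nbr_nonleaf v s : leaf v -> e v s -> ~~ leaf s.
Proof.
move=> lv vs; apply/negP => ls.
have all2 : forall w, w \in [set v; s].
  apply: (@closed_all _ v); first by rewrite !inE eqxx.
  move=> x y; rewrite !inE => /orP[/eqP->|/eqP->].
    by move/(leaf_nbr lv vs) ->; rewrite eqxx orbT.
  by rewrite e_sym in vs; move/(leaf_nbr ls vs) ->; rewrite eqxx.
have : #|T| <= #|[set v; s]| by apply: subset_leq_card; apply/subsetP => w _.
by rewrite cards2; case: (_ != _); rewrite cardT; lia.
Qed.

(** The form in which the algebra uses whiskers: [X] is the set of non-leaves and [s] exchanges each
    leaf with its unique neighbor. *)
Lemma whisker_pairing : whisker_graph e -> exists (X : {set T}) (s : T -> T),
  [/\ involutive s, forall v, (s v \in X) = (v \notin X),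
      forall v, s v \in cnbhd e v &
      forall v, v \notin X -> cnbhd e v = [set v; s v]].
Proof.
move=> wh; have [s Hs] : exists s : T -> T, forall v,
    [/\ e v (s v), leaf (s v) = ~~ leaf v & forall w, e v w -> leaf w = ~~ leaf v -> w = s v].
  apply: (fin_all_exists (P := fun v u => [/\ e v u, leaf u = ~~ leaf v
    & forall w, e v w -> leaf w = ~~ leaf v -> w = u])) => v; have [lv|nlv] := boolP (leaf v).
    have /leafP[s vs Es] := lv; exists s; split=> // [|w /Es //].
    exact/negbTE/(leaf_nbr_nonleaf lv vs).
  case: (wh v) => [/eqP lv|/eqP/cards1P[l El]]; first by rewrite /leaf lv in nlv.
  have /andP[vl ll] : e v l && leaf l by have := set11 l; rewrite -El inE.
  exists l; split=> // w vw lw; apply/set1P; rewrite -El inE vw; exact: lw.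
have sl v : leaf (s v) = ~~ leaf v by case: (Hs v).
have es v : e v (s v) by case: (Hs v).
have sK : involutive s.
  move=> v; apply/esym; have [_ _] := Hs (s v); apply; first by rewrite e_sym.
  by rewrite sl negbK.
exists [set v | ~~ leaf v], s; split=> // [v|v|v].
- by rewrite !inE sl.
- by rewrite inE es orbT.
rewrite inE negbK => lv; apply/setP => w; rewrite !inE.
by congr (_ || _); apply/idP/eqP => [/(leaf_nbr lv (es v))|->].
Qed.

(** * Structure of the graph when every dominating set has at least [n] elements *)

Hypothesis dom_ge : forall D, dominating e D -> n <= #|D|.

(* The complement of a maximal independent set is a dominating set of minimum
   size, so each of its elements has a private closed neighbour. *)
Lemma private_nbr A b : maximal_independent e A -> b \notin A ->
  (exists2 l, leaf l & e b l) \/ (forall w, e b w -> w \in A).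
Proof.
move=> mA bA; have cA := max_independent_card mA.
(* The complement of [A] has [n] elements, so without [b] it is too small to dominate; some [p] then
   has its closed neighborhood in [b |: A]. *)
have : ~~ dominating e (~: A :\ b).
  apply/negP => /dom_ge.
  have := cardsC A; have := cardsD1 b (~: A); rewrite inE bA cA cardT /=; lia.
case/dominatingPn => p /subsetP H.
have {}H w : w \in cnbhd e p -> w != b -> w \in A.
  by move/H; rewrite !inE negb_and !negbK => /orP[->|->].
have /andP[/indepP iA _] := mA.
(* If [p = b], all neighbors of [b] are in [A]; otherwise [p] is in [A], and independence leaves [b]
   as its only neighbor. *)
have [E|npb] := eqVneq p b.
  rewrite E in H; right=> w bw; apply: H; first by rewrite inE bw orbT.
  by apply: contraTneq bw => ->; rewrite e_irr.
have pA : p \in A by apply: H; rewrite // inE eqxx.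
have Hb w : e p w -> w = b.
  move=> pw; apply/eqP; apply: contraT => nwb.
  have wA : w \in A by apply: H; rewrite // inE pw orbT.
  by rewrite (negbTE (iA p w pA wA)) in pw.
have [w pw] := e_nbr p; have pb : e p b by rewrite -(Hb w pw).
by left; exists p; rewrite ?[e b p]e_sym //; apply/leafP; exists b.
Qed.

(** Exchanging both leaves for [s] in a maximal independent set that contains them would give a
    dominating set with fewer than [n] elements. *)
Lemma unique_leaf s l1 l2 : e s l1 -> e s l2 -> leaf l1 -> leaf l2 -> l1 = l2.
Proof.
move=> s1 s2 lf1 lf2; apply/eqP; apply: contraT => n12.
have e1 w : e l1 w -> w = s by apply: leaf_nbr; rewrite // e_sym.
have e2 w : e l2 w -> w = s by apply: leaf_nbr; rewrite // e_sym.
have ns1 : l1 != s by apply: contraTneq s1 => ->; rewrite e_irr.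
have ns2 : l2 != s by apply: contraTneq s2 => ->; rewrite e_irr.
have [|A mA /subsetP sA] := @extend_independent [set l1; l2].
  apply/indepP => x y; rewrite !inE => /orP[] /eqP-> /orP[] /eqP->; rewrite ?e_irr //.
    by apply/negP => /e1 E; rewrite E eqxx in ns2.
  by apply/negP => /e2 E; rewrite E eqxx in ns1.
have l1A : l1 \in A by apply: sA; rewrite !inE eqxx.
have l2A : l2 \in A by apply: sA; rewrite !inE eqxx orbT.
have /andP[/forallP dA _] := max_independent_dominating mA.
have : dominating e (s |: (A :\ l1 :\ l2)).
  apply/forallP => v; apply/set0Pn; have /set0Pn[w /setIP[wA wv]] := dA v.
  have [E1|n1] := eqVneq w l1.
    exists s; rewrite !inE eqxx /=; move: wv; rewrite inE E1 => /predU1P[<-|].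
      by rewrite e_sym s1 orbT.
    by rewrite e_sym => /e1->; rewrite eqxx.
  have [E2|n2] := eqVneq w l2.
    exists s; rewrite !inE eqxx /=; move: wv; rewrite inE E2 => /predU1P[<-|].
      by rewrite e_sym s2 orbT.
    by rewrite e_sym => /e2->; rewrite eqxx.
  by exists w; rewrite inE wv !inE n1 n2 wA orbT.
move/dom_ge; rewrite cardsU1.
have := cardsD1 l1 A; have := cardsD1 l2 (A :\ l1).
rewrite !inE l1A l2A (eq_sym l2) n12 /= (max_independent_card mA).
move=> E2 E1; rewrite E1 E2 !add1n.
by rewrite leqNgt ltnS -[X in _ <= X]add1n leq_add2r leq_b1.
Qed.

Definition inner w := ~~ leaf w /\ forall l, leaf l -> ~~ e w l.

(** If [u] and [x] were not adjacent, a maximal independent set containing both would avoid [w]; by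
    [private_nbr] it would contain every neighbor of [w], in particular [u'], which is adjacent to
    [x]. The case [x = u] shows that two neighbors of [w] are never adjacent. *)
Lemma inner_twins w u u' x : inner w -> e w u -> e w u' -> e u' x -> e u x.
Proof.
move=> [_ nsw] wu wu' u'x; apply: contraT => nux.
have [|A mA /subsetP sA] := @extend_independent [set u; x].
  apply/indepP => y z; rewrite !inE => /orP[] /eqP-> /orP[] /eqP->; rewrite ?e_irr //.
  by rewrite e_sym.
have /andP[/indepP iA _] := mA.
have uA : u \in A by apply: sA; rewrite !inE eqxx.
have xA : x \in A by apply: sA; rewrite !inE eqxx orbT.
have wA : w \notin A.
  by apply: contraL wu => wA; apply: iA.
case: (private_nbr mA wA) => [[l /nsw/negP //]|H].
by have := iA _ _ (H _ wu') xA; rewrite u'x.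
Qed.

(** By twinning, a leaf at [u] would also be adjacent to a second neighbor of [w]. *)
Lemma inner_nbr w u : inner w -> e w u -> inner u.
Proof.
move=> iw wu; have [nlw nsw] := iw; split.
  by apply: contraL wu; apply: nsw.
move=> l ll; apply/negP => ul; have [u' wu' /eqP] := nonleaf_nbr nlw wu; apply.
have u'l := inner_twins iw wu' wu ul.
by apply: (leaf_nbr ll); rewrite e_sym.
Qed.

Lemma inner_C4 w : inner w -> is_C4 e.
Proof.
move=> iw; have [u wu] := e_nbr w; have iu := inner_nbr iw wu.
have uw : e u w by rewrite e_sym.
have [u' wu' nu] := nonleaf_nbr (proj1 iw) wu.
have [w' uw' nw] := nonleaf_nbr (proj1 iu) uw.
(* The neighborhoods of [w] and [u] turn out to be the two sides of a complete bipartite graph. *)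
pose X := [set x | e w x]; pose Y := [set y | e u y].
have XY x : (x \in X) || (x \in Y).
  rewrite -in_setU; apply: (@closed_all _ w); first by rewrite !inE uw orbT.
  move=> y z; rewrite !inE => /orP[wy|uy] yz; apply/orP.
    by right; apply: (inner_twins iw wu wy).
  by left; apply: (inner_twins iu uw uy).
have eX x y : e x y = (x \in X) (+) (y \in X).
  rewrite !inE; have := XY x; have := XY y; rewrite !inE.
  case wy: (e w y) => /=; case wx: (e w x) => //=.
  - move=> _ _; apply/negP => xy; have := inner_twins iw wy wx xy.
    by rewrite e_irr.
  - by move=> _ ux; rewrite e_sym; apply: (inner_twins iw wy wu ux).
  - by move=> uy _; apply: (inner_twins iw wx wu uy).
  - move=> uy ux; apply/negP => xy.
    by have := inner_twins iu uy ux xy; rewrite e_irr.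
have uX : u \in X by rewrite inE.
have u'X : u' \in X by rewrite inE.
have wX : w \in X = false by rewrite inE e_irr.
have w'X : w' \in X = false by have := uw'; rewrite eX uX /= => /negbTE.
have neqX x y : x \in X -> y \in X = false -> (x == y) = false.
  by move=> xX yX; apply: contraFF yX => /eqP <-.
(* One vertex from each side dominates, which forces [n = 2]. *)
have d2 : dominating e [set w; u].
  apply/forallP => v; apply/set0Pn; case/orP: (XY v); rewrite inE => H.
    by exists w; rewrite !inE eqxx e_sym H orbT.
  by exists u; rewrite !inE eqxx (e_sym v) H !orbT.
have n2 : n = 2%N.
  apply/eqP; rewrite eqn_leq n_ge2 andbT; apply: leq_trans (dom_ge d2) _.
  by rewrite cards2; case: (_ != _).
(* This order alternates the sides, and adjacency in [C4_adj] is difference of parity. *)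
pose r := [:: w; u; w'; u'].
have ur : uniq r.
  rewrite /= !inE !negb_or eq_sym (neqX u w) // eq_sym nw (eq_sym w) (neqX u' w) //=.
  by rewrite (neqX u w') //= eq_sym nu eq_sym (neqX u' w').
have allr x : x \in r.
  have /subset_cardP : #|r| = #|T| by rewrite (card_uniqP ur) cardT n2.
  by move/(_ (subset_predT _)) => ->.
have ltr x : (index x r < 4)%N by rewrite (_ : 4 = size r) // index_mem.
pose f x : 'I_4 := Ordinal (ltr x).
have f_inj : injective f.
  move=> x y Exy; have E : index x r = index y r := congr1 val Exy.
  by rewrite -(nth_index w (allr x)) E nth_index ?allr.
exists f; split.
  by apply: inj_card_bij => //; rewrite card_ord cardT n2.
have iX x : (x \in X) = odd (index x r).
  have := allr x; rewrite !inE => /or4P[] /eqP->; rewrite -?[e w _]/(_ \in X).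
  - by rewrite /= eqxx e_irr.
  - by rewrite wu /= eq_sym (neqX u w) // eqxx.
  - have := w'X; rewrite inE => ->.
    by rewrite /= eq_sym (negbTE nw) (neqX u w') // eqxx.
  - by rewrite wu' /= eq_sym (neqX u' w) // eq_sym (negbTE nu) eq_sym (neqX u' w') // eqxx.
have fE x : f x = index x r :> nat by [].
move=> x y; rewrite eX !iX /C4_adj !fE; move: (ltr x) (ltr y).
by move: (index x r) (index y r) => [|[|[|[|i]]]] [|[|[|[|j]]]].
Qed.

Lemma C4_or_whisker : is_C4 e \/ whisker_graph e.
Proof.
have [/existsP[w /andP[nl /forall_inP H]]|/existsPn H] :=
  boolP [exists w, ~~ leaf w && [forall l in leaf, ~~ e w l]].
  by left; apply: (@inner_C4 w); split.
right=> v; have := H v; rewrite negb_and negbK => /orP[/eqP|]; first by left.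
case/forall_inPn => l ll; rewrite negbK => vl; right; apply/eqP/cards1P; exists l.
apply/setP => w; rewrite !inE; apply/andP/eqP => [[vw lw]|->]; last by [].
exact: unique_leaf vw vl lw ll.
Qed.

End Combinatorics.

Local Open Scope ring_scope.

(** * Regular sequences *)

Section Ideals.
Variable R : comPzRingType.
Implicit Types (I J L : R -> Prop) (f g p q : R) (fs gs : seq R).

Lemma ideal_opp I p : is_ideal I -> I p -> I (- p).
Proof. by case=> _ _ HM Ip; rewrite -mulN1r; apply: HM. Qed.

Lemma ideal_sub I p q : is_ideal I -> I p -> I q -> I (p - q).
Proof.
by move=> iI Ip /(ideal_opp iI); case: iI => _ HD _; apply: HD.
Qed.

Lemma ideal_mulr I p q : is_ideal I -> I p -> I (p * q).
Proof. by case=> _ _ HM Ip; rewrite mulrC; apply: HM. Qed.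

Lemma ideal_addl I p q : is_ideal I -> I p -> I (p + q) -> I q.
Proof.
by move=> iI Ip Ipq; rewrite -[q](addKr p) addrC; apply: ideal_sub.
Qed.

Lemma ideal_sum I (A : Type) (r : seq A) (P : pred A) (F : A -> R) :
  is_ideal I -> (forall i, P i -> I (F i)) -> I (\sum_(i <- r | P i) F i).
Proof. by case=> H0 HD _ HF; elim/big_ind: _. Qed.

Lemma ideal_of_nil p : ideal_of [::] p <-> p = 0.
Proof.
split=> [[cs ->]|->]; first by rewrite big_ord0.
by exists [::]; rewrite big_ord0.
Qed.

Lemma ideal_of_cons g gs p :
  ideal_of (g :: gs) p <-> exists a, ideal_of gs (p - a * g).
Proof.
split=> [[cs ->]|[a [cs E]]].
  exists cs`_0, (behead cs); rewrite big_ord_recl /= addrC addKr.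
  by apply: eq_bigr => i _; rewrite nth_behead.
by exists (a :: cs); rewrite big_ord_recl /= -E addrC subrK.
Qed.

Lemma ideal_of_is_ideal gs : is_ideal (ideal_of gs).
Proof.
elim: gs => [|g gs [H0 HD HM]].
  split=> [|a b|r a]; rewrite !ideal_of_nil // => -> //; last by rewrite mulr0.
  by move=> ->; rewrite addr0.
split=> [|a b|r a]; rewrite !ideal_of_cons.
- by exists 0; rewrite mul0r subr0.
- move=> [x Hx] [y Hy]; exists (x + y).
  by rewrite mulrDl opprD addrACA; apply: HD.
- by move=> [x Hx]; exists (r * x); rewrite -mulrA -mulrBr; apply: HM.
Qed.

Lemma ideal_of_sub J gs p : is_ideal J -> (forall g, g \in gs -> J g) ->
  ideal_of gs p -> J p.
Proof.
move=> iJ HJ [cs ->]; apply: ideal_sum => // i _.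
by case: iJ => _ _ HM; apply/HM/HJ/mem_nth.
Qed.

Lemma ideal_of_mem gs g : g \in gs -> ideal_of gs g.
Proof.
elim: gs => // h gs IH; rewrite inE ideal_of_cons => /predU1P[->|/IH Hg].
  by exists 1; rewrite mul1r subrr; case: (ideal_of_is_ideal gs).
by exists 0; rewrite mul0r subr0.
Qed.

Lemma ideal_of_subset fs gs p :
  {subset fs <= gs} -> ideal_of fs p -> ideal_of gs p.
Proof.
move=> sub; apply: ideal_of_sub; first exact: ideal_of_is_ideal.
by move=> g /sub; apply: ideal_of_mem.
Qed.

Definition iplus I f : R -> Prop := fun p => exists b, I (p - b * f).

Lemma iplus_is_ideal I f : is_ideal I -> is_ideal (iplus I f).
Proof.
case=> H0 HD HM; split=> [|p q [a Ha] [b Hb]|r p [a Ha]].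
- by exists 0; rewrite mul0r subr0.
- by exists (a + b); rewrite mulrDl opprD addrACA; apply: HD.
- by exists (r * a); rewrite -mulrA -mulrBr; apply: HM.
Qed.

Lemma iplus_sub I f p : I p -> iplus I f p.
Proof. by exists 0; rewrite mul0r subr0. Qed.

Lemma iplus_gen I f : is_ideal I -> iplus I f f.
Proof. by case=> H0 _ _; exists 1; rewrite mul1r subrr. Qed.

Lemma iplus_ext I J f : (forall p, I p <-> J p) ->
  forall p, iplus I f p <-> iplus J f p.
Proof. by move=> E p; split=> -[b /E]; exists b. Qed.

Lemma iaddP I gs p : iadd I (ideal_of gs) p <->
  exists2 q, ideal_of gs q & I (p - q).
Proof.
split=> [[a [b [Ia [Jb ->]]]]|[q Jq Ipq]]; first by exists b; rewrite ?addrK.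
by exists (p - q), q; rewrite subrK.
Qed.

Lemma iadd_is_ideal I J : is_ideal I -> is_ideal J -> is_ideal (iadd I J).
Proof.
case=> I0 ID IM [J0 JD JM]; split.
- by exists 0, 0; rewrite addr0.
- move=> _ _ [a [b [Ia [Jb ->]]]] [a' [b' [Ia' [Jb' ->]]]].
  by exists (a + a'), (b + b'); rewrite addrACA; do !split; auto.
- move=> r _ [a [b [Ia [Jb ->]]]].
  by exists (r * a), (r * b); rewrite mulrDr; do !split; auto.
Qed.

Lemma iadd_nil I p : iadd I (ideal_of [::]) p <-> I p.
Proof.
rewrite iaddP; split=> [[q /ideal_of_nil ->]|Ip]; first by rewrite subr0.
by exists 0; rewrite ?subr0 // ideal_of_nil.
Qed.

Lemma iadd_cons I f fs p :
  iadd I (ideal_of (f :: fs)) p <-> iadd (iplus I f) (ideal_of fs) p.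
Proof.
rewrite !iaddP; split=> [[q /ideal_of_cons[a Ha] Ipq]|[q Hq [b Hb]]].
  by exists (q - a * f) => //; exists a; rewrite opprB addrA addrAC addrK.
exists (q + b * f); last by rewrite opprD addrA.
by apply/ideal_of_cons; exists b; rewrite addrK.
Qed.

Lemma nzd_mod_ext I J f : (forall p, I p <-> J p) -> nzd_mod I f -> nzd_mod J f.
Proof. by move=> E H g /E /H /E. Qed.

Lemma nzd_modX I f k : nzd_mod I f -> nzd_mod I (f ^+ k).
Proof.
move=> H; elim: k => [|k IH] g; first by rewrite mul1r.
by rewrite exprS -mulrA => /H /IH.
Qed.

(** Weak regularity: the nonzerodivisor condition alone, as a recursion from the front. Properness
    is kept separate in [regular_seqP]. *)
Fixpoint wreg I fs : Prop :=
  if fs is f :: fs' then nzd_mod I f /\ wreg (iplus I f) fs' else True.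

Lemma wreg_ext I J fs : (forall p, I p <-> J p) -> wreg I fs -> wreg J fs.
Proof.
elim: fs I J => //= f fs IH I J E [H1 H2]; split; first exact: nzd_mod_ext H1.
exact: IH (iplus_ext f E) H2.
Qed.

Lemma wregP I fs : wreg I fs <->
  forall i, (i < size fs)%N -> nzd_mod (iadd I (ideal_of (take i fs))) fs`_i.
Proof.
elim: fs I => [|f fs IH] I //=; split=> [[H1 /IH H2] [|i] /= Hi|H].
- by apply: nzd_mod_ext H1 => p; rewrite iadd_nil.
- by apply: nzd_mod_ext (H2 i Hi) => p; rewrite iadd_cons.
- split; first by apply: nzd_mod_ext (H 0%N isT) => p; rewrite take0 iadd_nil.
  by apply/IH => i Hi; apply: nzd_mod_ext (H i.+1 Hi) => p /=; rewrite iadd_cons.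
Qed.

Lemma regular_seqP I fs :
  regular_seq I fs <-> wreg I fs /\ ~ iadd I (ideal_of fs) 1.
Proof. by rewrite /regular_seq wregP. Qed.

Lemma wreg_rcons I fs f :
  wreg I (rcons fs f) <-> wreg I fs /\ nzd_mod (iadd I (ideal_of fs)) f.
Proof.
elim: fs I => [|g fs IH] I /=.
  split=> [[H _]|[_ H]]; split=> //; apply: nzd_mod_ext H => p;
  by rewrite iadd_nil.
rewrite IH; split=> [[H1 [H2 H3]]|[[H1 H2] H3]]; do !split => //;
  by apply: nzd_mod_ext H3 => p; rewrite iadd_cons.
Qed.

(* Regularity on both ends of 0 -> R/(L:a) -> R/L -> R/(L+a) -> 0 gives
   regularity in the middle. *)
Lemma wreg_mid L a fs : is_ideal L ->
  wreg (iplus L a) fs -> wreg (fun p => L (a * p)) fs -> wreg L fs.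
Proof.
elim: fs L => //= f fs IH L iL [p1 p2] [q1 q2].
have nzdf: nzd_mod L f.
  (* Modulo [L], [w] is [b * a]; then [f * b] lies in the colon by [a], hence so does [b]. *)
  move=> w Lfw; have [b Lb] := p1 w (iplus_sub a Lfw).
  rewrite -[w](subrK (b * a)); case: (iL) => _ HD HM.
  apply: HD => //; rewrite mulrC; apply: q1.
  rewrite mulrCA (mulrC a).
  apply: (ideal_addl iL (HM f _ Lb)); by rewrite -mulrDr subrK.
split=> //; apply: IH; first exact: iplus_is_ideal.
  apply: wreg_ext p2 => p; split=> -[b [c Hc]]; exists c, b;
  by rewrite addrAC.
(* Adding [f] commutes with the colon by [a]: if [a * p - z * f] is in [L], regularity of [f] modulo
   [L + (a)] makes [z] a multiple of [a] modulo [L]. *)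
apply: wreg_ext q2 => p; split=> [[b Hb]|[z Hz]].
  by exists (a * b); rewrite -mulrA -mulrBr.
have [|c Hc] := p1 z.
  exists p; rewrite -[X in L X]opprB mulrC (mulrC f).
  exact: ideal_opp.
exists c; have -> : a * (p - c * f) = (a * p - z * f) + f * (z - c * a) by ring.
by case: (iL) => _ HD HM; apply: HD; do ?apply: HM.
Qed.

(** Induction on the exponent by [wreg_mid] with [a = f]: from the ideal with the next power of [f],
    the colon by [f] lowers the power and the sum with [f] gives [I + (f)]. *)
Lemma wreg_powers I fs k : is_ideal I ->
  wreg I fs -> wreg I [seq f ^+ k.+1 | f <- fs].
Proof.
elim: fs I => //= f fs IH I iI [H1 H2]; split; first exact: nzd_modX.
apply: IH; first exact: iplus_is_ideal.
elim: k => [|k IHk]; first by rewrite expr1.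
apply: (@wreg_mid _ f); first exact: iplus_is_ideal.
  apply: wreg_ext H2 => p; split=> [[b Hb]|[b [c Hc]]].
    by exists b; apply: iplus_sub.
  exists (b + c * f ^+ k.+1).
  by rewrite mulrDl opprD addrA -mulrA -exprSr.
apply: wreg_ext IHk => p; split=> -[b Hb]; exists b.
  rewrite exprS mulrCA -mulrBr.
  by case: iI => _ _; apply.
by apply: H1; rewrite mulrBr mulrCA -exprS.
Qed.

(** The source of the freeness of I/I^2. Regularity of the last element controls the last
    coefficient; the others follow by induction. *)
Lemma wreg_syzygy L fs (c : nat -> R) : is_ideal L -> wreg L fs ->
  L (\sum_(i < size fs) c i * fs`_i) ->
  forall i, (i < size fs)%N -> iadd L (ideal_of fs) (c i).
Proof.
move=> iL; elim/last_ind: fs c => // fs f IH c /wreg_rcons[H1 H2].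
rewrite size_rcons big_ord_recr /= nth_rcons ltnn eqxx.
rewrite (eq_bigr (fun i : 'I_(size fs) => c i * fs`_i)); last first.
  by move=> i _; rewrite nth_rcons ltn_ord.
move=> Hs; have sub p: iadd L (ideal_of fs) p ->
    iadd L (ideal_of (rcons fs f)) p.
  rewrite !iaddP => -[q Hq Hp]; exists q => //; apply: ideal_of_subset Hq => x.
  by rewrite mem_rcons inE orbC => ->.
have: iadd L (ideal_of fs) (c (size fs)).
  apply: H2; apply/iaddP; exists (- \sum_(i < size fs) c i * fs`_i).
    apply: ideal_opp; first exact: ideal_of_is_ideal.
    exists (mkseq c (size fs)); apply: eq_bigr => i _; by rewrite nth_mkseq.
  by rewrite opprK addrC mulrC.
move=> Hlast i; rewrite ltnS leq_eqVlt => /predU1P[->|lti]; first exact: sub.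
have /iaddP[_ [cs ->] Hcs] := Hlast.
(* Substituting the last coefficient, a combination of [fs] modulo [L], gives a relation on [fs]
   with these coefficients. *)
have: iadd L (ideal_of fs) (c i + cs`_i * f).
  apply: (IH (fun j => c j + cs`_j * f)) => //.
  rewrite (eq_bigr (fun j : 'I_(size fs) => c j * fs`_j + f * (cs`_j * fs`_j)));
    last by move=> j _; rewrite mulrDl -mulrA mulrCA.
  rewrite big_split /= -mulr_sumr.
  move: Hs Hcs; set s1 := \sum_(_ < _) _; set s2 := \sum_(_ < _) _ => Hs Hcs.
  have -> : s1 + f * s2 = s1 + c (size fs) * f - f * (c (size fs) - s2).
    by ring.
  by apply: ideal_sub => //; case: iL => _ _; apply.
move=> /sub Hi; have iA : is_ideal (iadd L (ideal_of (rcons fs f))).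
  by apply: iadd_is_ideal => //; apply: ideal_of_is_ideal.
rewrite -[c i](addrK (cs`_i * f)); apply: ideal_sub => //.
case: (iA) => _ _; apply; apply/iaddP; exists f.
  by apply: ideal_of_mem; rewrite mem_rcons mem_head.
by rewrite subrr; case: iL.
Qed.

End Ideals.

(** * Algebraic dependence *)

(** Vectors of [d] exponents below [k], nested as pairs so that the peeling argument can recurse on
    [d]. *)
Fixpoint expo (k d : nat) : finType :=
  if d is d'.+1 then ('I_k * expo k d')%type : finType else unit : finType.

Lemma card_expo k d : #|expo k d| = (k ^ d)%N.
Proof.
by elim: d => [|d IH] /=; rewrite ?card_unit // card_prod card_ord IH expnS.
Qed.

Fixpoint powers (R : pzRingType) (k d : nat) : expo k d -> (nat -> R) -> R :=
  match d return expo k d -> (nat -> R) -> R with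
  | d'.+1 => fun a f => f 0%N ^+ a.1 * powers a.2 (fun i => f i.+1)
  | 0 => fun _ _ => 1
  end.

Lemma powers_morph (R S : pzRingType) (phi : {rmorphism R -> S}) k d
  (a : expo k d) (f : nat -> R) : phi (powers a f) = powers a (fun i => phi (f i)).
Proof.
elim: d a f => [|d IH] a f /=; first exact: rmorph1.
by rewrite rmorphM rmorphXn IH.
Qed.

Section Peel.
Variables (K : fieldType) (R : comAlgType K).

(* Peeling off the lowest power of [f 0] from an algebraic relation pushes it
   from [Q 0] into [Q 1]; iterating, only a nonzero constant survives. *)
Lemma algdep_tower (d k : nat) (Q : nat -> R -> Prop) (f : nat -> R) (g : R)
    (c : expo k d -> K) :
  (forall i, (i <= d)%N -> is_ideal (Q i)) ->
  (forall i, (i < d)%N -> [/\ forall p, Q i p -> Q i.+1 p, Q i.+1 (f i)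
      & nzd_mod (Q i) (f i)]) ->
  (exists a, c a != 0) ->
  Q 0%N (g * \sum_a c a *: powers a f) -> Q d g.
Proof.
elim: d Q f g c => [|d IH] Q f g c iQ HQ [a0 ca0].
  have iQ0 := iQ 0%N isT; rewrite (bigD1 tt) //= big1; last by case.
  case: a0 ca0 => ca0; rewrite addr0 -scalerAr mulr1 => H.
  rewrite -[g]scale1r -(mulVf ca0) -scalerA -mulr_algl.
  by case: iQ0 => _ _; apply.
have iQ0 := iQ 0%N isT; have [Q01 Q1f nzdf] := HQ 0%N isT.
pose f' i := f i.+1.
pose G (i : 'I_k) := \sum_(a : expo k d) c (i, a) *: powers a f'.
have -> : \sum_a c a *: powers a f = \sum_(i < k) f 0%N ^+ i * G i.
  under [RHS]eq_bigr do rewrite mulr_sumr.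
  rewrite pair_bigA /=; apply: eq_bigr => -[i a] _ /=.
  by rewrite -scalerAr.
have Pex : exists n, [exists i : 'I_k, (i == n :> nat) && [exists a, c (i, a) != 0]].
  case: a0 ca0 => i a Hc; exists i; apply/existsP; exists i; rewrite eqxx.
  by apply/existsP; exists a.
case: (ex_minnP Pex) => n0 /existsP[i0 /andP[/eqP<- /existsP[a Hc]]] min0.
rewrite (bigD1 i0) //=.
(* [i0] is the lowest exponent of [f 0] with a nonzero coefficient: terms below it vanish and those
   above are divisible by the next power. *)
have -> : \sum_(i < k | i != i0) f 0%N ^+ i * G i = f 0%N ^+ i0 *
    (f 0%N * \sum_(i < k | i != i0) f 0%N ^+ (i - i0.+1) * G i).
  rewrite !mulr_sumr; apply: eq_bigr => i ne; rewrite mulrA -exprSr mulrA.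
  case: (ltnP i0 i) => [lt|le]; first by rewrite -exprD subnKC.
  have -> : G i = 0; last by rewrite !mulr0.
  apply: big1 => b _; case: (eqVneq (c (i, b)) 0) => [->|nz].
    by rewrite scale0r.
  have := min0 i; rewrite leqNgt ltn_neqAle [X in X && _]ne le.
  move=> H; suff: false by []; apply: H.
  by apply/existsP; exists i; rewrite eqxx; apply/existsP; exists b.
(* Cancelling that power leaves [g * G i0] plus a multiple of [f 0], and the latter lies in
   [Q 1]. *)
rewrite -mulrDr mulrCA => /(nzd_modX nzdf).
rewrite mulrDr mulrCA => /Q01 H1.
apply: (IH (fun i => Q i.+1) f' g (fun b => c (i0, b))).
- by move=> i lei; apply: (iQ i.+1).
- by move=> i lti; apply: (HQ i.+1).
- by exists a.
have iQ1 := iQ 1%N isT; apply: (ideal_addl iQ1 _ (p := f 0%N * _)).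
  exact: ideal_mulr Q1f.
by rewrite addrC; apply: H1.
Qed.

Lemma wreg_algdep (k : nat) (I : R -> Prop) (fs : seq R) (g : R)
    (c : expo k (size fs) -> K) :
  is_ideal I -> wreg I fs -> (exists a, c a != 0) ->
  I (g * \sum_a c a *: powers a (nth 0 fs)) -> iadd I (ideal_of fs) g.
Proof.
move=> iI /wregP wI nzc Hg.
have iQ i : is_ideal (iadd I (ideal_of (take i fs))).
  by apply: iadd_is_ideal => //; apply: ideal_of_is_ideal.
rewrite -[fs in ideal_of fs]take_size.
apply: (algdep_tower (Q := fun i => iadd I (ideal_of (take i fs))) _ _ nzc).
- by move=> i _; apply: iQ.
- move=> i lti; split; last exact: wI.
    move=> p /iaddP[q Hq Hpq]; apply/iaddP; exists q => //.
    apply: ideal_of_subset Hq => x.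
    by rewrite (take_nth 0 lti) mem_rcons inE orbC => ->.
  apply/iaddP; exists fs`_i; last by rewrite subrr; case: iI.
  by apply: ideal_of_mem; rewrite (take_nth 0 lti) mem_rcons mem_head.
- by apply/iaddP; exists 0; rewrite ?subr0 // take0 ideal_of_nil.
Qed.

(** An element outside the prime [Q i] is a nonzerodivisor modulo it, so peeling with [g = 1] would
    put 1 into the last prime. *)
Lemma prime_chain_algdep (d k : nat) (Q : nat -> R -> Prop) (f : nat -> R)
    (c : expo k d -> K) :
  (forall i, (i <= d)%N -> prime_ideal (Q i)) ->
  (forall i, (i < d)%N -> [/\ forall p, Q i p -> Q i.+1 p, Q i.+1 (f i)
      & ~ Q i (f i)]) ->
  (exists a, c a != 0) -> ~ Q 0%N (\sum_a c a *: powers a f).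
Proof.
move=> pQ HQ nzc H; have [_ + _] := pQ d (leqnn d); apply.
apply: (algdep_tower (f := f) (c := c)) => //.
- by move=> i /pQ[].
- move=> i lti; have [H1 H2 H3] := HQ i lti; split => // g.
  by have [_ _ HP] := pQ i (ltnW lti); case/HP.
- by rewrite mul1r.
Qed.

End Peel.

Section Dependence.
Variables (K : fieldType) (N : nat).
Implicit Types (V : {set 'I_N}) (p q : {mpoly K[N]}).

Definition box V (B : nat) : pred 'X_{1..N} :=
  fun m => [forall i, (m i <= (i \in V) * B)%N].

Definition boxed V B p := forall m, p@_m != 0 -> box V B m.

Lemma boxed1 V : boxed V 0 1.
Proof.
move=> m; rewrite mcoeff1; have [-> _|_] := eqVneq m 0%MM; last by rewrite eqxx.
by apply/forallP => i; rewrite mnm0E.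
Qed.

Lemma boxedM V B1 B2 p q : boxed V B1 p -> boxed V B2 q -> boxed V (B1 + B2) (p * q).
Proof.
move=> Hp Hq m; rewrite -mcoeff_msupp => /msuppM_le /allpairsP[[m1 m2] /=].
rewrite !mcoeff_msupp => -[/Hp /forallP H1 /Hq /forallP H2 ->].
apply/forallP => i; rewrite mnmDE mulnDr; apply: leq_add; [exact: H1|exact: H2].
Qed.

Lemma boxedX V B p k : boxed V B p -> boxed V (k * B) (p ^+ k).
Proof.
move=> Hp; elim: k => [|k IH]; first exact: boxed1.
by rewrite exprS mulSn; apply: boxedM.
Qed.

Lemma boxedW V B B' p : (B <= B')%N -> boxed V B p -> boxed V B' p.
Proof.
move=> le H m /H /forallP Hm; apply/forallP => i.
by apply: leq_trans (Hm i) _; rewrite leq_mul2l le orbT.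
Qed.

Lemma boxed_powers V B k d (a : expo k d) (f : nat -> {mpoly K[N]}) :
  (forall i, (i < d)%N -> boxed V B (f i)) -> boxed V (d * (k * B)) (powers a f).
Proof.
elim: d a f => [|d IH] a f Hf /=; first exact: boxed1.
rewrite mulSn; apply: boxedM; last by apply: IH => i lti; apply: (Hf i.+1).
have H0 := Hf 0%N isT; have le : (a.1 * B <= k * B)%N by rewrite leq_mul2r ltnW ?orbT.
by apply: (boxedW le); apply: boxedX.
Qed.

Definition box_mnm V B (t : {ffun {i | i \in V} -> 'I_B.+1}) : 'X_{1..N} :=
  [multinom (if insub i is Some j then (t j : nat) else 0%N) | i < N].

Lemma box_mnmP V B m : box V B m -> exists t : {ffun {i | i \in V} -> 'I_B.+1}, m = box_mnm t.
Proof.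
move=> /forallP Hm; exists [ffun j : {i | i \in V} => inord (m (val j)) : 'I_B.+1].
apply/mnmP => i; rewrite mnmE; case: insubP => [j iV vj|niV].
  by rewrite ffunE vj inordK //; move: (Hm i); rewrite iV mul1n.
by have := Hm i; rewrite (negbTE niV) mul0n leqn0 => /eqP.
Qed.

(* The k^d monomials of exponents below k in the f i are linear combinations
   of at most (d k B + 1)^#|V| monomials. *)
Lemma algdep V B d (f : nat -> {mpoly K[N]}) : (#|V| < d)%N ->
  (forall i, (i < d)%N -> boxed V B (f i)) ->
  exists k (c : expo k d -> K),
    (exists a, c a != 0) /\ \sum_a c a *: powers a f = 0.
Proof.
(* With this [k], [k ^ d] is at least [k ^ #|V| * k], which exceeds [(k * (d * B).+1) ^ #|V|], a
   bound for the number of monomials in the box. *)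
move=> ltVd Hf; pose k := ((d * B).+1 ^ #|V|).+1; exists k.
pose B' := (d * (k * B))%N.
pose A := \matrix_(i < #|expo k d|, j < #|{ffun {i | i \in V} -> 'I_B'.+1}|)
   (powers (enum_val i) f)@_(box_mnm (enum_val j)).
have ltA : (#|{ffun {i | i \in V} -> 'I_B'.+1}| < #|expo k d|)%N.
  rewrite card_ffun card_sig card_ord card_expo.
  have -> : #|[pred x | x \in V]| = #|V| by apply: eq_card => x; rewrite inE.
  apply: (@leq_trans (k ^ #|V|.+1)); last exact: leq_pexp2l.
  apply: (@leq_ltn_trans ((k * (d * B).+1) ^ #|V|)).
    have [->|V0] := posnP #|V|; first by rewrite !expn0.
    rewrite leq_exp2r // /B' mulnCA mulnS -add1n. by rewrite leq_add2r.
  by rewrite expnMn expnSr ltn_pmul2l // expn_gt0.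
have nzk : kermx A != 0.
  rewrite -mxrank_eq0 mxrank_ker subn_eq0 -ltnNge.
  exact: leq_ltn_trans (rank_leq_col A) ltA.
pose v := nz_row (kermx A).
have vA : v *m A = 0 by apply/sub_kermxP/nz_row_sub.
have /rV0Pn[j vj] : v != 0 by rewrite nz_row_eq0.
exists (fun a => v ord0 (enum_rank a)); split.
  by exists (enum_val j); rewrite enum_valK.
set s := \sum_a _; have bs : boxed V B' s.
  move=> m; rewrite raddf_sum /= => nz.
  have [/existsP[a Ha]|H] := boolP [exists a : expo k d, (powers a f)@_m != 0].
    exact: boxed_powers Ha.
  case/eqP: nz; apply: big1 => a _; rewrite mcoeffZ.
  by move/existsPn: H => /(_ a)/negPn/eqP->; rewrite mulr0.
apply/mpolyP => m; rewrite mcoeff0; apply/eqP; apply/negPn/negP => nz.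
have [t Et] := box_mnmP (bs m nz); case/eqP: nz.
move/matrixP: vA => /(_ ord0 (enum_rank t)); rewrite !mxE => <-.
rewrite raddf_sum /= (reindex (@enum_val _ (expo k d))) /=; last first.
  by apply: onW_bij; apply: enum_val_bij.
by apply: eq_bigr => i _; rewrite mcoeffZ !mxE enum_valK enum_rankK Et.
Qed.

End Dependence.

(** * Monomial ideals *)

Lemma ker_prime (R : comPzRingType) (S : idomainType) (phi : {rmorphism R -> S}) :
  prime_ideal (fun p => phi p = 0).
Proof.
split; first split.
- exact: rmorph0.
- by move=> a b; rewrite rmorphD => -> ->; rewrite addr0.
- by move=> r a; rewrite rmorphM => ->; rewrite mulr0.
- by move/eqP; rewrite rmorph1 oner_eq0.
- by move=> a b /eqP; rewrite rmorphM mulf_eq0 => /orP[] /eqP; [left|right].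
Qed.

Lemma ker_nzd (R : comPzRingType) (S : idomainType) (phi : {rmorphism R -> S}) f :
  phi f != 0 -> nzd_mod (fun p => phi p = 0) f.
Proof.
by move=> nz g /eqP; rewrite rmorphM mulf_eq0 (negbTE nz) => /eqP.
Qed.

Section Monomial.
Variables (K : fieldType) (N : nat).
Local Notation S := {mpoly K[N]}.
Local Notation mnm := 'X_{1..N}.
Implicit Types (U : pred mnm) (p q : S) (m : mnm) (D : {set 'I_N}).

(** A monomial ideal is represented by its set of exponents, so membership is tested coefficient by
    coefficient. *)
Definition mono U p := forall m, p@_m != 0 -> U m.

Definition upset U := forall m m', U m -> U (m + m')%MM.

Lemma mono_is_ideal U : upset U -> is_ideal (mono U).
Proof.
move=> uU; split=> [m|p q Hp Hq m|r p Hp m].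
- by rewrite mcoeff0 eqxx.
- rewrite mcoeffD; have [E|/Hp //] := eqVneq p@_m 0.
  by rewrite E add0r => /Hq.
- rewrite -mcoeff_msupp => /msuppM_le /allpairsP[[m1 m2] /= [_]].
  by rewrite mcoeff_msupp => /Hp Um2 ->; rewrite addmC; apply: uU.
Qed.

Lemma monoX U m : mono U 'X_[m] <-> U m.
Proof.
split=> [|Um m']; first by apply; rewrite mcoeffX eqxx oner_eq0.
by rewrite mcoeffX; have [<-|] := eqVneq m m'; rewrite // eqxx.
Qed.

Lemma mono_ext U U' : U =1 U' -> forall p, mono U p <-> mono U' p.
Proof. by move=> E p; split=> H m /H; rewrite E. Qed.

Lemma mono_sub U (J : S -> Prop) p :
  is_ideal J -> (forall m, U m -> J 'X_[m]) -> mono U p -> J p.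
Proof.
move=> iJ HJ Up; rewrite [p]mpolyE big_seq; apply: ideal_sum => // m.
rewrite mcoeff_msupp => /Up /HJ Jm; rewrite -mul_mpolyC.
by case: iJ => _ _; apply.
Qed.

Lemma mono_colon U m p : mono U ('X_[m] * p) <-> mono (fun k => U (m + k)%MM) p.
Proof.
rewrite mulrC; split=> H k; first by rewrite -(mcoeffMX p m); apply: H.
rewrite -mcoeff_msupp (perm_mem (msuppMX p m)) => /mapP[k' + ->].
by rewrite mcoeff_msupp; apply: H.
Qed.

Lemma mono_iplus U i p : upset U ->
  iplus (mono U) 'X_i p <-> mono (fun m => U m || (0 < m i)%N) p.
Proof.
move=> uU; split=> [[b Hb]|].
  rewrite -[p](subrK (b * 'X_i)) => m; rewrite mcoeffD.
  have [->|/Hb -> //] := eqVneq (p - b * 'X_i)@_m 0; rewrite add0r.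
  rewrite -mcoeff_msupp (perm_mem (msuppMX b U_(i))) => /mapP[k' _ ->].
  by rewrite mnmDE mnm1E eqxx orbT.
apply: mono_sub; first by apply: iplus_is_ideal; apply: mono_is_ideal.
move=> m /orP[Um|mi]; first by apply: iplus_sub; apply/monoX.
exists 'X_[m - U_(i)]; rewrite -mpolyXD submK ?subrr.
  by case: (mono_is_ideal uU).
by rewrite lep1mP -lt0n.
Qed.

(** The splitting step of all later regularity proofs: both the sum with a variable and the colon by
    it are again monomial. *)
Lemma wreg_mono_mid U i fs : upset U ->
  wreg (mono (fun m => U m || (0 < m i)%N)) fs ->
  wreg (mono (fun m => U (U_(i) + m)%MM)) fs -> wreg (mono U : S -> Prop) fs.
Proof.
move=> uU H1 H2; apply: (@wreg_mid _ _ 'X_i); first exact: mono_is_ideal.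
  by apply: wreg_ext H1 => p; rewrite mono_iplus.
by apply: wreg_ext H2 => p; rewrite mono_colon.
Qed.

Lemma ideal_of_mono (ms : seq mnm) p :
  ideal_of [seq 'X_[m] | m <- ms] p <->
  mono (fun m => has (fun m' => (m' <= m)%MM) ms) p.
Proof.
split.
  apply: ideal_of_sub; last first.
    move=> _ /mapP[m mms ->]; apply/monoX/hasP; exists m => //.
    by apply/mnm_lepP.
  apply: mono_is_ideal => m m' /hasP[k kms /mnm_lepP le].
  apply/hasP; exists k => //; apply/mnm_lepP => i.
  by rewrite mnmDE (leq_trans (le i)) ?leq_addr.
apply: mono_sub; first exact: ideal_of_is_ideal.
move=> m /hasP[k kms le]; rewrite -(submK le) mpolyXD.
have [_ _] := ideal_of_is_ideal [seq 'X_[K, m] | m <- ms]; apply.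
by apply: ideal_of_mem; apply: map_f.
Qed.

(** * Substitutions and primes generated by variables *)

Definition msubst (n' : nat) (h : 'I_N -> {mpoly K[n']}) : S -> {mpoly K[n']} :=
  comp_mpoly [tuple h i | i < N].

HB.instance Definition _ n' h := GRing.RMorphism.on (@msubst n' h).
HB.instance Definition _ n' h := GRing.Linear.on (@msubst n' h).

Lemma msubstX n' (h : 'I_N -> {mpoly K[n']}) m :
  msubst h 'X_[m] = \prod_i h i ^+ m i.
Proof.
by rewrite /msubst comp_mpolyX; apply: eq_bigr => i _; rewrite tnth_mktuple.
Qed.

Lemma msubstXU n' (h : 'I_N -> {mpoly K[n']}) i : msubst h 'X_i = h i.
Proof. by rewrite /msubst comp_mpolyXU -tnth_nth tnth_mktuple. Qed.

(** Serves to identify [J] with the kernel of a substitution; powers are compared by factoring their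
    difference. *)
Lemma msubst_mod (h : 'I_N -> S) (J : S -> Prop) p : is_ideal J ->
  (forall i, J ('X_i - h i)) -> J (p - msubst h p).
Proof.
move=> iJ HJ; case: (iJ) => J0 JD JM; elim/mpolyind: p => [|c m p _ _ IH].
  by rewrite linear0 subr0.
rewrite linearD linearZ /= opprD addrACA; apply: (JD) IH; rewrite -scalerBr.
rewrite -mul_mpolyC; apply: (JM); rewrite msubstX mpolyXE_id.
elim/big_rec2: _ => [|i b a _ IH]; first by rewrite subrr.
have -> : 'X_i ^+ m i * b - h i ^+ m i * a =
  'X_i ^+ m i * (b - a) + a * ('X_i ^+ m i - h i ^+ m i) by ring.
apply: (JD); first exact: JM; apply: (JM).
by rewrite subrXX; apply: ideal_mulr.
Qed.

(** [mono (meets D)] is the prime P_D generated by the variables in [D]; it is the kernel of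
    [kill D]. *)
Definition meets D : pred mnm := fun m => [exists i in D, 0 < m i]%N.

Lemma upset_meets D : upset (meets D).
Proof.
move=> m m' /existsP[i /andP[iD mi]]; apply/existsP; exists i.
by rewrite iD mnmDE (leq_trans mi) ?leq_addr.
Qed.

Definition kill D : S -> S := msubst (fun i => if i \in D then 0 else 'X_i).
HB.instance Definition _ D := GRing.RMorphism.on (kill D).
HB.instance Definition _ D := GRing.Linear.on (kill D).

Lemma killX D m : kill D 'X_[m] = if meets D m then 0 else 'X_[m].
Proof.
rewrite /kill msubstX; case: ifP => [/existsP[i /andP[iD mi]]|/negbT/existsPn H].
  by rewrite (bigD1 i) //= iD expr0n -[(_ == _)]negbK -lt0n mi mul0r.
rewrite [RHS]mpolyXE_id; apply: eq_bigr => i _; case: ifP => // iD.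
by move: (H i); rewrite iD lt0n negbK /= => /eqP->.
Qed.

Lemma mcoeff_kill D p m : (kill D p)@_m = if meets D m then 0 else p@_m.
Proof.
elim/mpolyind: p => [|c k p _ _ IH]; first by rewrite linear0 mcoeff0; case: ifP.
rewrite linearD linearZ /= !mcoeffD IH killX !mcoeffZ.
have [E|ne] := eqVneq k m.
  by rewrite E; case: ifP; rewrite ?mcoeff0 ?mulr0 ?addr0.
case: (meets D k); rewrite ?mcoeff0 ?mcoeffX ?(negbTE ne) !mulr0 !add0r //.
Qed.

Lemma pvarP D p : mono (meets D) p <-> kill D p = 0.
Proof.
split=> [H|H m].
  apply/mpolyP => m; rewrite mcoeff_kill mcoeff0; case: ifP => // /negbT nm.
  by apply/eqP; apply: contraNT nm => /H.
have := congr1 (mcoeff m) H; rewrite mcoeff_kill mcoeff0.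
by case: ifP => // _ ->; rewrite eqxx.
Qed.

Lemma prime_ext (I J : S -> Prop) : (forall p, I p <-> J p) -> prime_ideal I ->
  prime_ideal J.
Proof.
move=> E [[H0 HD HM] H1 HP]; split; first split.
- exact/E.
- by move=> a b /E Ia /E Ib; apply/E/HD.
- by move=> r a /E Ia; apply/E/HM.
- by move/E.
- by move=> a b /E /HP[] /E; [left|right].
Qed.

Lemma pvar_prime D : prime_ideal (mono (meets D)).
Proof.
by apply: prime_ext (ker_prime (kill D)) => p; rewrite pvarP.
Qed.

Lemma pvarXU D i : mono (meets D) 'X_i <-> i \in D.
Proof.
rewrite monoX; split=> [/existsP[j /andP[jD]]|iD].
  by rewrite mnm1E; case: eqP => // ->.
by apply/existsP; exists i; rewrite iD mnm1E eqxx.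
Qed.

Lemma pvar_sub D (J : S -> Prop) p :
  is_ideal J -> (forall i, i \in D -> J 'X_i) -> mono (meets D) p -> J p.
Proof.
move=> iJ HJ; apply: mono_sub => // m /existsP[i /andP[iD mi]].
rewrite -(@submK _ U_(i) m) ?lep1mP -?lt0n // mpolyXD.
by case: iJ => _ _; apply; apply: HJ.
Qed.

Lemma boxed_kill D p : boxed (~: D) (msize p) (kill D p).
Proof.
move=> m; rewrite mcoeff_kill; case: ifP => [_|/negbT/existsPn nD nz].
  by rewrite eqxx.
apply/forallP => i; rewrite inE; move: (nD i).
case: (i \in D) => /=; first by rewrite -leqNgt.
move=> _; rewrite mul1n ltnW //; apply: leq_ltn_trans (msize_mdeg_lt (_ : m \in msupp p)).
  by rewrite mdegE (bigD1 i) //= leq_addr.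
by rewrite mcoeff_msupp.
Qed.

(** Only the variables outside [D] survive in the images under [kill D], so [algdep] applies to
    these images. *)
Lemma algdep_mod_pvar D d (f : nat -> S) : (#|~: D| < d)%N ->
  exists k (c : expo k d -> K),
    (exists a, c a != 0) /\ mono (meets D) (\sum_a c a *: powers a f).
Proof.
move=> ltd; pose B := \max_(i < d) msize (f i).
have [i lti|k [c [nzc H]]] := algdep (B := B) (f := fun i => kill D (f i)) ltd.
  apply: (boxedW _ (@boxed_kill D (f i))).
  exact: (leq_bigmax (Ordinal lti)).
exists k, c; split=> //; apply/pvarP; rewrite linear_sum -[RHS]H /=.
by apply: eq_bigr => a _; rewrite linearZ /= powers_morph.
Qed.

(** * Bounds for depth and dimension *)

Definition ord_ge s : pred mnm := fun m => (s <= mdeg m)%N.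

Lemma upset_ord_ge s : upset (ord_ge s).
Proof. by move=> m m' H; rewrite /ord_ge mdegD (leq_trans H) ?leq_addr. Qed.

Lemma ord_geX p k : mono (ord_ge 1) p -> mono (ord_ge k) (p ^+ k).
Proof.
move=> Hp; elim: k => [|k IH] //= m.
rewrite exprS -mcoeff_msupp => /msuppM_le /allpairsP[[m1 m2] /=].
rewrite !mcoeff_msupp => -[/Hp H1 /IH H2 ->].
by rewrite /ord_ge mdegD -add1n leq_add.
Qed.

(* [D] is an associated prime of [I], realised by the annihilator of [g]. The
   exponent [s] is taken so large that the powers of the sequence miss [g]. *)
Lemma depth_bound (I : S -> Prop) D (g : S) s fs : is_ideal I ->
  (forall i, i \in D -> I ('X_i * g)) ->
  (forall q, mono (ord_ge s) q -> ~ I (g - q)) ->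
  wreg I fs -> (forall f, f \in fs -> mono (ord_ge 1) f) ->
  (size fs <= #|~: D|)%N.
Proof.
move=> iI HD Hg wI Mfs; rewrite leqNgt; apply/negP => ltd.
pose fs' := [seq f ^+ s.+1 | f <- fs].
have szfs : size fs' = size fs by rewrite size_map.
have [|k [c [nzc Hc]]] := @algdep_mod_pvar D (size fs') (nth 0 fs').
  by rewrite szfs.
(* The relation lies in P_D, hence annihilates [g] modulo [I]; peeling then puts [g] into [I] plus
   the powers. *)
have /iaddP[q Hq Igq] : iadd I (ideal_of fs') g.
  apply: (wreg_algdep iI (wreg_powers s iI wI) nzc).
  rewrite -/fs'; set F := (\sum_a _) in Hc *.
  apply: (@pvar_sub D (fun p => I (g * p)) F) => //.
    case: iI => I0 ID IM; split.
    - by rewrite mulr0.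
    - by move=> a b Ia Ib; rewrite mulrDr; apply: ID.
    - by move=> r a Ia; rewrite mulrCA; apply: IM.
  by move=> i iD; rewrite mulrC; apply: HD.
(* The powers have order at least [s], so [q] does too, and [Hg] excludes it. *)
apply: (Hg q) => //; apply: ideal_of_sub Hq.
  exact: mono_is_ideal (@upset_ord_ge s).
move=> _ /mapP[f /Mfs Hf ->] m /(ord_geX Hf); rewrite /ord_ge; exact: ltnW.
Qed.

(** Elements chosen in each prime outside the previous one would be algebraically dependent modulo
    the bottom prime if there were more than [#|~: D|] of them. *)
Lemma chain_bound (I : S -> Prop) Ps D d : prime_chain I Ps d ->
  (forall i, i \in D -> Ps 0%N 'X_i) -> (d <= #|~: D|)%N.
Proof.
move=> [H1 H2] HD; rewrite leqNgt; apply/negP => ltd.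
have [f Hf] := fin_all_exists (fun i : 'I_d => (H2 i (ltn_ord i)).2).
pose f' i := if insub i is Some j then f j else 0.
have [k [c [nzc Hc]]] := @algdep_mod_pvar D d f' ltd.
apply: (prime_chain_algdep (Q := Ps) (f := f') _ _ nzc).
- by move=> i /H1[].
- move=> i lti; have [Hsub _] := H2 i lti; rewrite /f' insubT /=.
  by have [] := Hf (Ordinal lti).
by apply: pvar_sub Hc => //; have [[]] := H1 0%N isT.
Qed.

(** The chain starts at P_D and adjoins the variables outside [D] one at a time. *)
Lemma pvar_chain (I : S -> Prop) D d :
  (forall p, I p -> mono (meets D) p) -> (d <= #|~: D|)%N ->
  exists Ps, prime_chain I Ps d.
Proof.
move=> ID ltd; pose s := enum (~: D).
pose E i := D :|: [set x in take i s].
have szs : size s = #|~: D| by rewrite -cardE.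
exists (fun i => mono (meets (E i))); split=> i lei.
  split=> [|p /ID]; first exact: pvar_prime.
  apply: pvar_sub; first by apply: mono_is_ideal; apply: upset_meets.
  by move=> j jD; apply/pvarXU; rewrite !inE jD.
have lts : (i < size s)%N by rewrite szs (leq_trans lei).
have x0 : 'I_N by move: lts; case: (s).
split=> [p|].
  apply: pvar_sub; first by apply: mono_is_ideal; apply: upset_meets.
  move=> j; rewrite !inE => H; apply/pvarXU; rewrite !inE (take_nth x0 lts).
  by rewrite mem_rcons inE orbCA H orbT.
exists 'X_(nth x0 s i); rewrite !pvarXU !inE (take_nth x0 lts).
rewrite mem_rcons mem_head orbT; split=> //.
have : nth x0 s i \in s by exact: mem_nth.
rewrite mem_enum inE => /negbTE -> /= /(nthP x0)[j].
rewrite size_take lts => ltj; rewrite nth_take // => /eqP.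
rewrite nth_uniq ?enum_uniq ?(ltn_trans ltj) // => /eqP eji.
by rewrite eji ltnn in ltj.
Qed.

Lemma dim_ge (I : S -> Prop) D d : dim_is I d ->
  (forall p, I p -> mono (meets D) p) -> (#|~: D| <= d)%N.
Proof.
move=> [_ Hd] ID; rewrite leqNgt; apply/negP => /(pvar_chain ID)[Ps].
exact: Hd.
Qed.

(** * Comparison of conormal generators at a general point of V(P_D) *)

Definition point D : 'I_N -> K := fun i => (i \notin D)%:R.

Lemma meval_pvar D p : mono (meets D) p -> p.@[point D] = 0.
Proof.
apply: (@mono_sub _ (fun p => p.@[point D] = 0)).
  by have [] := ker_prime (meval (point D)).
move=> m /existsP[i /andP[iD mi]]; rewrite mevalX (bigD1 i) //= /point iD.
by rewrite expr0n -[(_ == _)]negbK -lt0n mi mul0r.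
Qed.

Definition elt D (k : 'I_#|D|) : 'I_N := @enum_val _ (mem D) k.

Lemma elt_in D (k : 'I_#|D|) : elt k \in D.
Proof. exact: (@enum_valP _ (mem D)). Qed.

Lemma elt_inj D : injective (@elt D).
Proof. exact: (@enum_val_inj _ (mem D)). Qed.

Lemma elt_surj D i : i \in D -> exists k : 'I_#|D|, elt k = i.
Proof.
by move=> iD; exists (enum_rank_in iD i); apply: (@enum_rankK_in _ _ (mem D)).
Qed.

(** Differentiating in the variable [elt k] and evaluating where all variables of [D] vanish
    isolates [c k]. *)
Lemma pvar_syzygy D (c : 'I_#|D| -> S) :
  \sum_k c k * 'X_(elt k) = 0 -> forall k, (c k).@[point D] = 0.
Proof.
move=> H k; have HD (j : 'I_#|D|) : point D (elt j) = 0.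
  by rewrite /point elt_in.
have := congr1 (fun p => (mderiv (elt k) p).@[point D]) H.
rewrite /= mderiv0 meval0 (linear_sum (mderiv _)) rmorph_sum /= (bigD1 k) //=.
rewrite big1 => [|j ne]; rewrite mderivM mevalD !mevalM mevalXU HD mulr0 add0r
  mderivX mnm1E.
  have -> : (U_(elt k) - U_(elt k) = 0 :> mnm)%MM.
    by apply/mnmP => j; rewrite mnmBE subnn mnm0E.
  by rewrite eqxx /= scale1r mpolyX0 meval1 mulr1 addr0.
by rewrite (inj_eq (@elt_inj D)) (negbTE ne) /= scale0r meval0 mulr0.
Qed.

Lemma pvar_expand D p : mono (meets D) p ->
  exists a : 'I_#|D| -> S, p = \sum_k a k * 'X_(elt k).
Proof.
apply: (@pvar_sub D (fun p => exists a : 'I_#|D| -> S, p = \sum_k a k * 'X_(elt k))).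
  split=> [|{}p q [a ->] [b ->]|r {}p [a ->]].
  - by exists (fun=> 0); rewrite big1 // => k _; rewrite mul0r.
  - exists (fun k => a k + b k); rewrite -big_split.
    by apply: eq_bigr => i _; rewrite mulrDl.
  - exists (fun k => r * a k); rewrite mulr_sumr.
    by apply: eq_bigr => i _; rewrite mulrA.
move=> i iD; have [k0 <-] := elt_surj iD; exists (fun k => (k == k0)%:R).
rewrite (bigD1 k0) //= eqxx mul1r.
by rewrite big1 ?addr0 // => k /negbTE->; rewrite mul0r.
Qed.

(* At the point q which is 0 on D and 1 elsewhere, I and the prime (x_i : i in D)
   agree locally, and the two systems of generators of I/I^2 at q are
   exchanged by mutually inverse matrices. *)
Lemma ci_size (I : S -> Prop) fs D (u : S) :
  (forall p, I p <-> ideal_of fs p) -> wreg (@zero_ideal _) fs ->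
  (forall p, I p -> mono (meets D) p) -> (forall i, i \in D -> I ('X_i * u)) ->
  u.@[point D] = 1 -> size fs = #|D|.
Proof.
move=> EI wfs ID HD u1.
have i0 : is_ideal (@zero_ideal S).
  split=> [|a b|r a] //; rewrite /zero_ideal => ->; last by rewrite mulr0.
  by move=> ->; rewrite addr0.
have [a Ha] : exists a : 'I_(size fs) -> 'I_#|D| -> S,
    forall j : 'I_(size fs), fs`_j = \sum_k a j k * 'X_(elt k).
  apply: (fin_all_exists (P := fun (j : 'I_(size fs)) (b : 'I_#|D| -> S) =>
    fs`_j = \sum_k b k * 'X_(elt k))) => j.
  by apply/pvar_expand/ID/EI/ideal_of_mem/mem_nth.
have [b Hb] : exists b : 'I_#|D| -> seq S,
    forall k, 'X_(elt k) * u = \sum_(j < size fs) (b k)`_j * fs`_j.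
  apply: (fin_all_exists (P := fun k (b : seq S) =>
    'X_(elt k) * u = \sum_(j < size fs) b`_j * fs`_j)) => k.
  by apply/EI/HD/elt_in.
pose A : 'M[K]_(size fs, #|D|) := \matrix_(j, k) (a j k).@[point D].
pose B : 'M[K]_(#|D|, size fs) := \matrix_(k, j) ((b k)`_j).@[point D].
have AB : A *m B = 1%:M.
  apply/matrixP => j j'; rewrite !mxE.
  (* Expanding [u] times the j-th generator in the variables and back in [fs] gives a relation on
     [fs]; by [wreg_syzygy] its coefficients lie in [I] and vanish at the point. *)
  pose c (i : nat) := u * (i == j :> nat)%:R - \sum_k a j k * (b k)`_i.
  have Hc : \sum_(i < size fs) c i * fs`_i = 0.
    rewrite (eq_bigr (fun i : 'I_(size fs) => u * ((i == j)%:R * fs`_i)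
       - \sum_k a j k * ((b k)`_i * fs`_i))); last first.
      move=> i _; rewrite mulrBl mulrA mulr_suml; congr (_ - _).
      by apply: eq_bigr => k _; rewrite mulrA.
    rewrite sumrB -mulr_sumr (bigD1 j) //= eqxx mul1r big1 => [|i /negbTE nij].
      rewrite addr0 exchange_big /= [X in u * X]Ha mulr_sumr.
      apply/eqP; rewrite subr_eq0; apply/eqP/eq_bigr => k _.
      by rewrite -mulr_sumr -Hb; ring.
    by rewrite nij mul0r.
  have /iaddP[q /EI/ID/meval_pvar Hq E] := wreg_syzygy i0 wfs Hc (ltn_ord j').
  have {E Hq} : (c j').@[point D] = 0.
    by rewrite -[c j'](subrK q) E add0r.
  rewrite mevalB mevalM u1 mul1r rmorph_nat rmorph_sum /= eq_sym => /eqP.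
  rewrite subr_eq0 => /eqP ->.
  by apply: eq_bigr => k _; rewrite !mxE mevalM.
have BA : B *m A = 1%:M.
  apply/matrixP => k k'; rewrite !mxE.
  (* The same round trip from the variables; here [pvar_syzygy] makes the coefficients vanish. *)
  pose c i := u * (i == k)%:R - \sum_(j < size fs) (b k)`_j * a j i.
  have Hc : \sum_i c i * 'X_(elt i) = 0.
    rewrite (eq_bigr (fun i => u * ((i == k)%:R * 'X_(elt i))
       - \sum_(j < size fs) (b k)`_j * (a j i * 'X_(elt i)))); last first.
      move=> i _; rewrite mulrBl mulrA mulr_suml; congr (_ - _).
      by apply: eq_bigr => j _; rewrite mulrA.
    rewrite sumrB -mulr_sumr (bigD1 k) //= eqxx mul1r big1 => [|i /negbTE nij].
      rewrite addr0 exchange_big /= mulrC Hb.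
      apply/eqP; rewrite subr_eq0; apply/eqP/eq_bigr => j _.
      by rewrite -mulr_sumr -Ha.
    by rewrite nij mul0r.
  have := pvar_syzygy Hc k'.
  rewrite mevalB mevalM u1 mul1r rmorph_nat rmorph_sum /= eq_sym => /eqP.
  rewrite subr_eq0 => /eqP ->.
  by apply: eq_bigr => j _; rewrite !mxE mevalM.
apply/eqP; rewrite eqn_leq; apply/andP; split.
  exact: mulmx1_min AB.
exact: mulmx1_min BA.
Qed.

End Monomial.

(** * Closed neighborhood ideals *)

Section GraphIdeal.
Variables (K : fieldType) (T : finType) (e : rel T).
Local Notation N := #|T|.
Local Notation S := {mpoly K[N]}.
Local Notation mnm := 'X_{1..N}.
Local Notation rk := (@enum_rank T).
Local Notation I := (@NI T e K).
Local Notation M := (@hmax T K).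
Implicit Types (A D : {set T}) (m : mnm) (v w : T).

Definition mset A : mnm := [multinom (enum_val i \in A : nat) | i < N].

Lemma msetE A v : mset A (rk v) = (v \in A).
Proof. by rewrite mnmE enum_rankK. Qed.

Lemma mset_le A m : (mset A <= m)%MM = [forall w in A, 0 < m (rk w)]%N.
Proof.
apply/mnm_lepP/forall_inP => [H w wA|H i]; first by have := H (rk w); rewrite msetE wA.
rewrite -(enum_valK i) msetE; case: (boolP (_ \in A)) => //; apply: H.
Qed.

Lemma mdeg_mset A : mdeg (mset A) = #|A|.
Proof.
rewrite mdegE -sum1_card [RHS]big_mkcond (reindex rk) /=; last first.
  by apply: onW_bij; apply: enum_rank_bij.
by apply: eq_bigr => v _; rewrite msetE; case: (v \in A).
Qed.

Lemma prod_xv A : \prod_(w in A) xv K w = 'X_[mset A].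
Proof.
rewrite mpolyXE_id [LHS]big_mkcond [RHS](reindex rk) /=; last first.
  by apply: onW_bij; apply: enum_rank_bij.
by apply: eq_bigr => v _; rewrite msetE; case: (v \in A).
Qed.

Definition covers : pred mnm :=
  fun m => [exists v, [forall w in cnbhd e v, 0 < m (rk w)]]%N.

Lemma NI_mono p : I p <-> mono covers p.
Proof.
rewrite /NI (eq_map (fun v => prod_xv (cnbhd e v))).
rewrite (map_comp (fun m => 'X_[m])) ideal_of_mono; apply: mono_ext => m.
rewrite has_map; apply/hasP/existsP => [[v _ /=]|[v H]].
  by rewrite mset_le => H; exists v.
by exists v; rewrite /= ?mset_le // mem_enum.
Qed.

Lemma NI_is_ideal : is_ideal I.
Proof. exact: ideal_of_is_ideal. Qed.

Lemma hmax_mono p : M p <-> mono (ord_ge 1) p.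
Proof.
rewrite /hmax (map_comp (fun m => 'X_[m]) (fun v => U_(rk v)%MM)).
rewrite ideal_of_mono; apply: mono_ext => m.
rewrite has_map /ord_ge lt0n mdeg_eq0; apply/hasP/idP => [[v _ /=]|nz].
  by rewrite lep1mP; apply: contra => /eqP->; rewrite mnm0E.
have [i mi] : exists i, m i != 0%N.
  apply/existsP; apply: contraR nz => /existsPn H.
  by apply/eqP/mnmP => i; rewrite mnm0E; apply/eqP/negPn/H.
by exists (enum_val i); rewrite /= ?mem_enum // enum_valK lep1mP.
Qed.

Lemma hmax_xv v : M (xv K v).
Proof. by apply: ideal_of_mem; apply: map_f; rewrite mem_enum. Qed.

Lemma hmaxN1 : ~ M 1.
Proof.
by move/hmax_mono => /(_ 0%MM); rewrite mcoeff1 eqxx oner_eq0 /ord_ge mdeg0 => /(_ isT).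
Qed.

Lemma NI_hmax p : I p -> M p.
Proof.
apply: ideal_of_sub; first exact: ideal_of_is_ideal.
move=> _ /mapP[v _ ->]; rewrite (bigD1 v) ?inE ?eqxx //=.
by apply: ideal_mulr; [apply: ideal_of_is_ideal|apply: hmax_xv].
Qed.

Definition ranks D : {set 'I_N} := rk @: D.

Lemma mem_ranks D v : (rk v \in ranks D) = (v \in D).
Proof. by rewrite mem_imset //; apply: enum_rank_inj. Qed.

Lemma ranksP D i : i \in ranks D -> exists2 v, v \in D & i = rk v.
Proof. by case/imsetP => v; exists v. Qed.

Lemma card_ranks D : #|ranks D| = #|D|.
Proof. by apply: card_imset; apply: enum_rank_inj. Qed.

Lemma card_ranksC D : #|~: ranks D| = (#|T| - #|D|)%N.
Proof. by rewrite cardsCs setCK card_ranks card_ord. Qed.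

Lemma dominating_pvar D p : dominating e D -> I p -> mono (meets (ranks D)) p.
Proof.
move=> /forallP dD /NI_mono; apply: mono_sub.
  by apply: mono_is_ideal; apply: upset_meets.
move=> m /existsP[v /forall_inP H]; apply/monoX/existsP.
have /set0Pn[w /setIP[wD wv]] := dD v.
by exists (rk w); rewrite mem_ranks wD H.
Qed.

(** Minimality yields [w] whose closed neighborhood contains no vertex of [D] but [v]; the generator
    of [w] divides the product. *)
Lemma minimal_dominating_ann D v : minimal_dominating e D -> v \in D ->
  I (xv K v * 'X_[mset (~: D)]).
Proof.
move=> /andP[_ /forall_inP mD] /mD /dominatingPn[w /subsetP H].
apply/NI_mono; rewrite /xv -mpolyXD; apply/monoX/existsP; exists w.
apply/forall_inP => u /H; rewrite !inE negb_and negbK mnmDE msetE inE.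
by case/predU1P => [->|->]; rewrite ?mnm1E ?eqxx // addn1.
Qed.

Lemma NI_depth_le D fs : minimal_dominating e D ->
  seq_in M fs -> wreg I fs -> (size fs <= #|T| - #|D|)%N.
Proof.
move=> mD Mfs wfs; rewrite -card_ranksC.
(* The order [#|~: D|.+1] exceeds the degree of the monomial of [~: D], which is outside [NI]
   because [D] meets every closed neighborhood. *)
apply: (@depth_bound _ _ I (ranks D) 'X_[mset (~: D)] #|~: D|.+1 fs) => //.
- exact: NI_is_ideal.
- by move=> i /ranksP[v vD ->]; apply: minimal_dominating_ann.
- move=> q Hq /NI_mono /(_ (mset (~: D))); rewrite mcoeffB mcoeffX eqxx.
  have [->|/Hq] := eqVneq q@_(mset (~: D)) 0; last by rewrite /ord_ge mdeg_mset ltnn.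
  rewrite subr0 oner_eq0 => /(_ isT) /existsP[v /forall_inP H].
  have /andP[/forallP /(_ v) /set0Pn[w /setIP[wD wv]] _] := mD.
  have := H w wv.
  by rewrite msetE inE wD.
- by move=> f /(nthP 0)[i lti <-]; apply/hmax_mono/Mfs.
Qed.

(** For each minimal dominating [D] the depth is at most [#|T| - #|D|] and the dimension at least
    that; their equality determines [#|D|]. *)
Lemma cm_well_dominated : cohen_macaulay I M -> well_dominated e.
Proof.
move=> [d [[[fs [<- [Mfs /regular_seqP[wfs _]]]] _] dimd]].
suff H D : minimal_dominating e D -> #|D| = (#|T| - size fs)%N.
  by move=> D1 D2 /H-> /H->.
move=> mD; have le := NI_depth_le mD Mfs wfs.
have /andP[dD _] := mD.
have := dim_ge dimd (fun p => @dominating_pvar D p dD); rewrite card_ranksC => ge.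
have leT : (#|D| <= #|T|)%N by exact: max_card.
by have /eqP -> : size fs == (#|T| - #|D|)%N; rewrite ?subKn // eqn_leq le.
Qed.

Lemma ci_well_dominated : complete_intersection I -> well_dominated e.
Proof.
move=> [fs [EI /regular_seqP[wfs _]]].
suff H D : minimal_dominating e D -> #|D| = size fs.
  by move=> D1 D2 /H-> /H->.
move=> mD; have /andP[dD _] := mD; rewrite -card_ranks; apply/esym.
apply: (@ci_size _ _ I fs (ranks D) 'X_[mset (~: D)]) => //.
- by move=> p; apply: dominating_pvar.
- by move=> i /ranksP[v vD ->]; apply: minimal_dominating_ann.
rewrite mevalX big1 // => i _; rewrite /point -(enum_valK i) mem_ranks msetE inE.
by case: (_ \in D); rewrite ?expr0 ?expr1n.
Qed.

Lemma NI_dim D : dominating e D ->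
  (forall D', dominating e D' -> #|D| <= #|D'|)%N -> dim_is I (#|T| - #|D|).
Proof.
move=> dD minD; split.
  apply: (@pvar_chain _ _ I (ranks D)); last by rewrite card_ranksC.
  by move=> p; apply: dominating_pvar.
move=> Ps HPs; have [/(_ 0%N isT)[pP0 IP0] _] := HPs.
have [_ P01 P0M] := pP0.
(* The bottom prime contains a variable from each closed neighborhood, hence the variables of a
   dominating set, and [chain_bound] applies. *)
have P0v v : exists w, w \in cnbhd e v /\ Ps 0%N (xv K w).
  have : Ps 0%N (\prod_(w in cnbhd e v) xv K w).
    by apply: IP0; apply: ideal_of_mem; apply: map_f; rewrite mem_enum.
  elim/big_rec: _ => [/P01 //|w p wv IH /P0M[H|/IH //]]; by exists w.
have [f Hf] := fin_all_exists P0v.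
pose D' := [set f v | v in T].
have dD' : dominating e D'.
  apply/forallP => v; apply/set0Pn; exists (f v); rewrite inE imset_f //.
  by case: (Hf v).
have := chain_bound (D := ranks D') HPs; rewrite card_ranksC => H.
have /H : forall i, i \in ranks D' -> Ps 0%N 'X_i.
  by move=> i /ranksP[_ /imsetP[v _ ->] ->]; case: (Hf v).
by apply/negP; rewrite -ltnNge ltnS leq_sub2l ?minD.
Qed.

(** Properness holds because [NI] and the sequence lie in the proper ideal [M]; no longer sequence
    exists by [NI_depth_le]. *)
Lemma NI_cm_witness D fs : minimal_dominating e D ->
  (forall D', dominating e D' -> #|D| <= #|D'|)%N ->
  size fs = (#|T| - #|D|)%N -> seq_in M fs -> wreg I fs ->
  [/\ dim_is I (#|T| - #|D|), depth_is I M (#|T| - #|D|) & regular_seq I fs].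
Proof.
move=> mD minD szfs Mfs wfs; have /andP[dD _] := mD.
have rfs : regular_seq I fs.
  apply/regular_seqP; split=> // /iaddP[q Hq /NI_hmax Hm]; apply: hmaxN1.
  have iM : is_ideal M by apply: ideal_of_is_ideal.
  rewrite -[1](subrK q); case: (iM) => _ HD _; apply: HD => //.
  by apply: ideal_of_sub Hq => // f /(nthP 0)[i lti <-]; apply: Mfs.
split=> //; first exact: NI_dim.
split; first by exists fs.
by move=> gs Mgs /regular_seqP[wgs _]; apply: NI_depth_le.
Qed.

End GraphIdeal.

(** * Whisker graphs *)

Section Whisker.
Variables (K : fieldType) (T : finType) (e : rel T).
Local Notation N := #|T|.
Local Notation S := {mpoly K[N]}.
Local Notation mnm := 'X_{1..N}.
Local Notation rk := (@enum_rank T).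
Local Notation I := (@NI T e K).
Local Notation M := (@hmax T K).
Local Notation x := (@xv T K).

Variables (X : {set T}) (s : T -> T).
Hypothesis sK : involutive s.
Hypothesis sX : forall v, (s v \in X) = (v \notin X).
Hypothesis s_cnbhd : forall v, s v \in cnbhd e v.
Hypothesis cnbhd_leaf : forall v, v \notin X -> cnbhd e v = [set v; s v].

Lemma pairing_neq v : (s v == v) = false.
Proof. by apply/eqP => E; have := sX v; rewrite E; case: (v \in X). Qed.

Lemma pairing_neq_in v w : v \in X -> w \in X -> (s v == w) = false.
Proof. by move=> vX wX; apply/eqP => E; have := sX v; rewrite E vX wX. Qed.

Lemma rkE v w : (rk v == rk w) = (v == w).
Proof. exact: inj_eq enum_rank_inj v w. Qed.

Lemma mnm1_rk v w : U_(rk v)%MM (rk w) = (v == w) :> nat.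
Proof. by rewrite mnm1E rkE. Qed.

Definition edge_mnm v : pred mnm := fun m => (0 < m (rk v))%N && (0 < m (rk (s v)))%N.

(** The ideal generated by the variables in [Z] and the products [x v * x (s v)] for [v] in [vs],
    met when the edges are resolved one by one. *)
Definition partial_mnm (Z : {set T}) (vs : seq T) : pred mnm :=
  fun m => [exists v in Z, 0 < m (rk v)]%N || has (edge_mnm^~ m) vs.

Lemma upset_partial Z vs : upset (partial_mnm Z vs).
Proof.
have le (m m' : mnm) i : (0 < m i -> 0 < (m + m')%MM i)%N.
  by rewrite mnmDE => /leq_trans; apply; apply: leq_addr.
move=> m m' /orP[/exists_inP[v vZ mv]|/hasP[v vvs /andP[m1 m2]]]; apply/orP.
  by left; apply/exists_inP; exists v => //; apply: le.
by right; apply/hasP; exists v => //; apply/andP; split; apply: le.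
Qed.

Lemma meets_ranks (Z : {set T}) (m : mnm) :
  meets (ranks Z) m = [exists v in Z, 0 < m (rk v)]%N.
Proof.
apply/existsP/exists_inP => [[i /andP[/ranksP[v vZ ->] mv]]|[v vZ mv]]; first by exists v.
by exists (rk v); rewrite mem_ranks vZ.
Qed.

(** With one vertex of each pair in [Z], the difference is up to sign a variable modulo P_Z.
    Adjoining it adds the whole pair to [Z] and leaves the other pairs untouched. *)
Lemma wreg_transversal (Z : {set T}) vs : uniq vs -> {subset vs <= X} ->
  (forall v, v \in vs -> (v \in Z) (+) (s v \in Z)) ->
  wreg (mono (meets (ranks Z))) [seq x v - x (s v) | v <- vs].
Proof.
elim: vs Z => //= v vs IH Z /andP[nv uvs] sub HZ.
have vX : v \in X by apply: sub; rewrite mem_head.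
split.
  apply: (@nzd_mod_ext _ (fun p => kill (ranks Z) p = 0)).
    by move=> p; rewrite pvarP.
  apply: ker_nzd.
  rewrite rmorphB /= /xv !killX !meets_ranks.
  have E w : [exists u in Z, (0 < (U_(rk w)%MM : mnm) (rk u))%N] = (w \in Z).
    apply/exists_inP/idP => [[u uZ]|wZ]; last by exists w; rewrite ?mnm1_rk ?eqxx.
    by rewrite mnm1_rk lt0b => /eqP->.
  rewrite !E; have := HZ v (mem_head _ _).
  have nzX (i : 'I_N) : 'X_i != 0 :> S.
    by apply/eqP => /(congr1 (mcoeff U_(i))); rewrite mcoeffX mcoeff0 eqxx => /eqP;
      rewrite oner_eq0.
  by case: (v \in Z); case: (s v \in Z); rewrite // ?sub0r ?subr0 ?oppr_eq0.
pose Z' := v |: (s v |: Z).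
have iZ (Y : {set T}) : is_ideal (mono (meets (ranks Y)) : S -> Prop).
  by apply: mono_is_ideal; apply: upset_meets.
apply: (@wreg_ext _ (mono (meets (ranks Z')))); last first.
  apply: IH => // [w wvs|w wvs]; first by apply: sub; rewrite inE wvs orbT.
  have wX : w \in X by apply: sub; rewrite inE wvs orbT.
  have nwv : w != v by apply: contraNneq nv => <-.
  rewrite !inE (inj_eq (inv_inj sK)) (negbTE nwv) (pairing_neq_in wX vX) eq_sym.
  rewrite (pairing_neq_in vX wX) /=.
  by apply: HZ; rewrite inE wvs orbT.
move=> p; split.
  apply: pvar_sub; first exact: iplus_is_ideal.
  have H1 := iplus_gen (x v - x (s v)) (iZ Z).
  have iP := iplus_is_ideal (x v - x (s v)) (iZ Z).
  have HZZ w : w \in Z -> iplus (mono (meets (ranks Z))) (x v - x (s v)) (x w).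
    by move=> wZ; apply: iplus_sub; apply/pvarXU; rewrite mem_ranks.
  have Hv := HZ v (mem_head _ _).
  move=> _ /ranksP[w + ->]; rewrite !inE => /or3P[/eqP->|/eqP->|/HZZ //].
    have [/HZZ //|nvZ] := boolP (v \in Z); move: Hv; rewrite (negbTE nvZ) => /HZZ Hs.
    by rewrite -[X in iplus _ _ X](subrK (x (s v))); case: (iP) => _ HD _; apply: HD.
  have [/HZZ //|nvZ] := boolP (s v \in Z); move: Hv; rewrite (negbTE nvZ) addbF => /HZZ Hs.
  rewrite -[X in iplus _ _ X](subKr (x v)); exact: ideal_sub.
move=> [b Hb]; have xZ' w : w \in Z' -> mono (meets (ranks Z')) (x w : S).
  by move=> wZ; apply/pvarXU; rewrite mem_ranks.
rewrite -[p](subrK (b * (x v - x (s v)))); case: (iZ Z') => _ HD HM; apply: HD.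
  apply: pvar_sub Hb; first exact: iZ.
  by move=> _ /ranksP[w wZ ->]; apply: xZ'; rewrite !inE wZ !orbT.
by apply: HM; apply: (ideal_sub (iZ Z')); apply: xZ'; rewrite !inE eqxx ?orbT.
Qed.

(** Splitting at [x v] for an unresolved edge: the sum puts [v] into [Z], the colon puts [s v]
    there. When no edge is left, [wreg_transversal] applies. *)
Lemma wreg_partial (Z : {set T}) ps vs : uniq vs -> {subset vs <= X} ->
  uniq ps -> {subset ps <= X} ->
  (forall v, v \in ps -> v \notin Z /\ s v \notin Z) ->
  (forall v, v \in X -> v \notin ps -> (v \in Z) (+) (s v \in Z)) ->
  wreg (mono (partial_mnm Z ps)) [seq x v - x (s v) | v <- vs].
Proof.
move=> uvs svs; elim: ps Z => [|v ps IH] Z ups sps HZ1 HZ2.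
  apply: wreg_ext (wreg_transversal uvs svs (Z := Z) _).
    by apply: mono_ext => m; rewrite meets_ranks /partial_mnm orbF.
  by move=> v /svs vX; apply: HZ2.
move: ups => /= /andP[nv ups]; have vX : v \in X by apply: sps; rewrite mem_head.
have {}sps : {subset ps <= X} by move=> w wps; apply: sps; rewrite inE wps orbT.
have [nvZ nsvZ] := HZ1 v (mem_head _ _).
have HU (Y : {set T}) u (m : mnm) : [exists w in u |: Y, 0 < m (rk w)]%N =
    (0 < m (rk u))%N || [exists w in Y, 0 < m (rk w)]%N.
  apply/exists_inP/orP => [[w]|[mu|/exists_inP[w wY mw]]].
  - rewrite !inE => /predU1P[-> ->|wY mw]; first by left.
    by right; apply/exists_inP; exists w.
  - by exists u => //; rewrite !inE eqxx.
  - by exists w => //; rewrite !inE wY orbT.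
have key u : u = v \/ u = s v -> wreg (mono (partial_mnm (u |: Z) ps))
    [seq x v - x (s v) | v <- vs].
  move=> Hu; apply: IH => // [w wps|w wX nwps].
    have wX := sps w wps; have nwv : w != v by apply: contraNneq nv => <-.
    have [|H1 H2] := HZ1 w; first by rewrite inE wps orbT.
    rewrite !inE !negb_or H1 H2 !andbT; case: Hu => ->.
      by rewrite nwv (pairing_neq_in wX vX).
    by rewrite eq_sym (pairing_neq_in vX wX) (inj_eq (inv_inj sK)) nwv.
  have [->|nwv] := eqVneq w v.
    rewrite !inE (negbTE nvZ) (negbTE nsvZ) !orbF.
    by case: Hu => ->; rewrite eqxx ?pairing_neq // eq_sym pairing_neq.
  have := HZ2 w wX; rewrite !inE (negbTE nwv) => /(_ nwps).
  case: Hu => ->; first by rewrite (negbTE nwv) (pairing_neq_in wX vX).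
  by rewrite (inj_eq (inv_inj sK)) (negbTE nwv) eq_sym (pairing_neq_in vX wX).
apply: (wreg_mono_mid (i := rk v)); first exact: upset_partial.
  apply: wreg_ext (key v (or_introl erefl)); apply: mono_ext => m.
  rewrite /partial_mnm HU /= /edge_mnm.
  by case: (0 < m (rk v))%N; rewrite ?orbT // orbF.
apply: wreg_ext (key (s v) (or_intror erefl)); apply: mono_ext => m.
rewrite /partial_mnm HU /= /edge_mnm !mnmDE !mnm1_rk eqxx eq_sym pairing_neq add0n add1n /=.
rewrite orbCA -orbA; congr (_ || (_ || _)).
  apply: eq_existsb => w; rewrite mnmDE mnm1_rk.
  by have [<-|] := eqVneq v w; rewrite ?(negbTE nvZ).
apply: eq_in_has => w wps; rewrite !mnmDE !mnm1_rk.
have wX := sps w wps; have /negbTE nwv : w != v by apply: contraNneq nv => <-.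
by rewrite eq_sym nwv (eq_sym v) (pairing_neq_in wX vX).
Qed.

(** Every closed neighborhood contains a pair [v], [s v], and that of a vertex outside [X] is
    exactly such a pair, so the edge products generate [NI]. *)
Lemma covers_edges m : covers e m = partial_mnm set0 (enum X) m.
Proof.
have -> : partial_mnm set0 (enum X) m = has (edge_mnm^~ m) (enum X).
  rewrite /partial_mnm; case: existsP => //= -[v]; by rewrite inE.
apply/existsP/hasP => [[v /forall_inP H]|[v]].
  have Hv := H v; rewrite inE eqxx in Hv; have Hs := H _ (s_cnbhd v).
  have [vX|nvX] := boolP (v \in X).
    by exists v; rewrite ?mem_enum // /edge_mnm Hv.
  by exists (s v); rewrite ?mem_enum ?sX // /edge_mnm sK Hs Hv.
rewrite mem_enum => vX /andP[m1 m2]; exists (s v).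
apply/forall_inP => w; rewrite cnbhd_leaf ?sX ?vX // !inE sK.
by case/predU1P => [->|/eqP->].
Qed.

Definition edge_diffs : seq S := [seq x v - x (s v) | v <- enum X].

Lemma wreg_edge_diffs : wreg I edge_diffs.
Proof.
apply: wreg_ext (wreg_partial (Z := set0) (ps := enum X) (vs := enum X) _ _ _ _ _ _);
  rewrite ?enum_uniq //; try by move=> v; rewrite mem_enum.
- by move=> p; rewrite NI_mono; apply: mono_ext => m; rewrite covers_edges.
- by move=> v _; rewrite !inE.
- by move=> v vX; rewrite mem_enum vX.
Qed.

Lemma card_cores : #|T| = (#|X| + #|X|)%N.
Proof.
rewrite -(cardsC X); congr (_ + _)%N.
rewrite -(card_imset (mem X) (inv_inj sK)); apply: eq_card => v.
rewrite inE; apply/idP/imsetP => [nvX|[w wX ->]]; last by rewrite sX negbK.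
by exists (s v); rewrite ?sX ?sK.
Qed.

Lemma edge_mem_NI v : v \in X -> I (x v * x (s v)).
Proof.
move=> vX; apply/NI_mono; rewrite /xv -mpolyXD; apply/monoX.
rewrite covers_edges; apply/orP; right; apply/hasP; exists v; first by rewrite mem_enum.
by rewrite /edge_mnm !mnmDE !mnm1_rk !eqxx addn1.
Qed.

Lemma NI_sub_edges (J : S -> Prop) p : is_ideal J ->
  (forall v, v \in X -> J (x v * x (s v))) -> I p -> J p.
Proof.
move=> iJ HJ /NI_mono; apply: mono_sub => // m.
rewrite covers_edges => /orP[/existsP[v]|/hasP[v]]; rewrite ?inE // mem_enum.
move=> vX /andP[m1 m2]; rewrite -(@submK _ (U_(rk v) + U_(rk (s v))) m).
  by rewrite !mpolyXD; case: iJ => _ _; apply; apply: HJ.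
apply/mnm_lepP => i; rewrite -(enum_valK i) mnmDE !mnm1_rk.
have [<-|_] := eqVneq v; first by rewrite pairing_neq.
by have [<-|_] := eqVneq (s v).
Qed.

Lemma whisker_complete_intersection : complete_intersection I.
Proof.
exists [seq x v * x (s v) | v <- enum X].
have mE p : I p <-> ideal_of [seq x v * x (s v) | v <- enum X] p.
  split; last first.
    apply: ideal_of_sub; first exact: NI_is_ideal.
    by move=> _ /mapP[v + ->]; rewrite mem_enum; apply: edge_mem_NI.
  apply: NI_sub_edges; first exact: ideal_of_is_ideal.
  by move=> v vX; apply: ideal_of_mem; apply: map_f; rewrite mem_enum.
split=> //; apply/regular_seqP; split; last first.
  move/iaddP => [q /mE/NI_hmax Hq]; rewrite /zero_ideal => /eqP.
  by rewrite subr_eq0 => /eqP E; apply: (@hmaxN1 K T); rewrite E.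
have : {subset enum X <= X} by move=> v; rewrite mem_enum.
elim/last_ind: (enum X) (enum_uniq X) => [|vs v IH] //.
rewrite rcons_uniq map_rcons => /andP[nv uvs] sub.
have vX : v \in X by apply: sub; rewrite mem_rcons mem_head.
have {}sub : {subset vs <= X} by move=> w wvs; apply: sub; rewrite mem_rcons inE wvs orbT.
apply/wreg_rcons; split; first exact: IH.
pose U : pred mnm := fun m => has (edge_mnm^~ m) vs.
apply: (@nzd_mod_ext _ (mono U)) => [p|p].
  have -> : [seq x v * x (s v) | v <- vs] =
     [seq 'X_[m] | m <- [seq (U_(rk v) + U_(rk (s v)))%MM | v <- vs]].
    by rewrite -map_comp; apply: eq_map => w /=; rewrite mpolyXD.
  rewrite iaddP; split=> [Up|[q Hq /eqP]].
    exists p; last by rewrite subrr.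
    apply/ideal_of_mono => m /Up /hasP[w wvs /andP[m1 m2]].
    rewrite has_map; apply/hasP; exists w => //=.
    apply/mnm_lepP => i; rewrite -(enum_valK i) mnmDE !mnm1_rk.
    have [<-|_] := eqVneq w; first by rewrite pairing_neq.
    by have [<-|_] := eqVneq (s w).
  rewrite subr_eq0 => /eqP->; move/ideal_of_mono: Hq => Hq m /Hq.
  rewrite has_map => /hasP[w wvs /= /mnm_lepP le]; apply/hasP; exists w => //.
  have := le (rk w); have := le (rk (s w)); rewrite !mnmDE !mnm1_rk !eqxx.
  by rewrite pairing_neq eq_sym pairing_neq => l1 l2; apply/andP.
(* Distinct pairs are disjoint, so multiplying by the product of a new pair does not affect
   divisibility by the earlier ones. *)
rewrite /xv -mpolyXD => /mono_colon H m /H /hasP[w wvs].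
have wX := sub w wvs; have /negbTE nwv : w != v by apply: contraNneq nv => <-.
rewrite /edge_mnm !mnmDE !mnm1_rk (eq_sym v) nwv (eq_sym v) (pairing_neq_in wX vX).
rewrite (pairing_neq_in vX wX) (inj_eq (inv_inj sK)) (eq_sym v) nwv => Hm.
by apply/hasP; exists w.
Qed.

Lemma cores_minimal_dominating : minimal_dominating e X.
Proof.
apply/andP; split.
  apply/forallP => v; apply/set0Pn; have [vX|nvX] := boolP (v \in X).
    by exists v; rewrite !inE vX eqxx.
  by exists (s v); rewrite inE sX nvX s_cnbhd.
apply/forall_inP => v vX; apply/forallPn; exists (s v); rewrite negbK.
apply/eqP/setP => w; rewrite cnbhd_leaf ?sX ?vX // !inE sK.
have [->|_] := eqVneq w v; first by [].
by have [->|] := eqVneq w (s v); rewrite ?sX ?vX // andbF.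
Qed.

(** The closed neighborhoods of the vertices outside [X] are disjoint pairs, one for each element of
    [X], and [D'] meets all of them. *)
Lemma cores_card_min D' : dominating e D' -> (#|X| <= #|D'|)%N.
Proof.
move=> /forallP dD; pose r v := if v \in X then v else s v.
apply: leq_trans (leq_imset_card r D'); apply: subset_leq_card.
apply/subsetP => v vX; have /set0Pn[w] := dD (s v).
rewrite cnbhd_leaf ?sX ?vX // !inE sK => /andP[wD Hw].
apply/imsetP; exists w => //; rewrite /r.
by case/predU1P: Hw => [->|/eqP->]; rewrite ?sX vX ?sK.
Qed.

(** * The Gorenstein property of a whisker graph *)

Definition rho v := if v \in X then v else s v.

Lemma rhoX v : rho v \in X.
Proof. by rewrite /rho; case: ifP => // /negbT; rewrite sX. Qed.

Definition fold : S -> S := msubst (fun i => x (rho (enum_val i))).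
HB.instance Definition _ := GRing.RMorphism.on fold.
HB.instance Definition _ := GRing.Linear.on fold.

Definition nonsqfree : pred mnm := fun m => [exists v, 1 < m (rk v)]%N.

Lemma upset_nonsqfree : upset nonsqfree.
Proof.
move=> m m' /existsP[v H]; apply/existsP; exists v.
by rewrite mnmDE (leq_trans H) ?leq_addr.
Qed.

Lemma fold_x v : fold (x v) = x (rho v).
Proof. by rewrite /fold /xv msubstXU enum_rankK. Qed.

Lemma kill_x v : v \in X -> kill (ranks (~: X)) (x v) = x v.
Proof. by move=> vX; rewrite /kill msubstXU mem_ranks inE vX. Qed.

(** Expresses that [fold] takes values in the polynomials in the variables of [X]. *)
Lemma kill_fold p : kill (ranks (~: X)) (fold p) = fold p.
Proof.
elim/mpolyind: p => [|c m p _ _ IH]; first by rewrite !linear0.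
have kX : kill (ranks (~: X)) (fold 'X_[m]) = fold 'X_[m].
  rewrite /fold msubstX rmorph_prod; apply: eq_bigr => i _.
  by rewrite rmorphXn /= kill_x ?rhoX.
have -> : fold (c *: 'X_[m] + p) = c *: fold 'X_[m] + fold p by exact: linearP.
have -> (q r : S) : kill (ranks (~: X)) (c *: q + r) =
    c *: kill (ranks (~: X)) q + kill (ranks (~: X)) r by exact: linearP.
by rewrite IH kX.
Qed.

Local Notation J := (iadd I (ideal_of edge_diffs)).

Lemma foldable_is_ideal : is_ideal J.
Proof. by apply: iadd_is_ideal; apply: ideal_of_is_ideal. Qed.

Lemma NI_foldable p : I p -> J p.
Proof.
move=> Ip; apply/iaddP; exists 0; rewrite ?subr0 //.
by case: (ideal_of_is_ideal edge_diffs).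
Qed.

Lemma diff_foldable v : J (x v - x (s v)).
Proof.
have H w : w \in X -> J (x w - x (s w)).
  move=> wX; apply/iaddP; exists (x w - x (s w)); last first.
    by rewrite subrr; case: (NI_is_ideal K e).
  by apply: ideal_of_mem; apply: map_f; rewrite mem_enum.
have [/H //|nvX] := boolP (v \in X).
have := H (s v); rewrite sX sK => /(_ nvX) /(ideal_opp foldable_is_ideal).
by rewrite opprB.
Qed.

(* Modulo the sequence x_v - x_(s v), the quotient is K[x_v : v in X]/(x_v^2). *)
Lemma foldableP p : J p <-> mono nonsqfree (fold p).
Proof.
have iS := @mono_is_ideal K _ _ upset_nonsqfree.
have iJ := foldable_is_ideal; split.
  case/iaddP => q Hq Hpq; rewrite -[p](subrK q) rmorphD /=.
  have iF : is_ideal (fun p => mono nonsqfree (fold p)).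
    case: iS => S0 SD SM; split.
    - by rewrite linear0.
    - by move=> a b Ha Hb; rewrite rmorphD; apply: SD.
    - by move=> r a Ha; rewrite rmorphM; apply: SM.
  case: (iS) => S0 SD SM; apply: SD.
    apply: (NI_sub_edges iF) Hpq => v vX; rewrite rmorphM /= !fold_x.
    have -> : rho (s v) = rho v by rewrite /rho sX vX sK.
    rewrite /xv -mpolyXD; apply/monoX/existsP; exists (rho v).
    by rewrite mnmDE mnm1_rk eqxx.
  apply: (ideal_of_sub iF) Hq => _ /mapP[v vX ->]; rewrite rmorphB /= !fold_x.
  by rewrite /rho sX; move: vX; rewrite mem_enum => ->; rewrite sK subrr.
move=> Hf; rewrite -[p](subrK (fold p)); case: (iJ) => _ JD JM; apply: (JD).
  apply: msubst_mod => // i; rewrite -{1}(enum_valK i) -/(x _) /rho.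
  by case: ifP => _; [rewrite subrr; case: iJ|apply: diff_foldable].
apply: mono_sub Hf => // m /existsP[v mv].
rewrite -(@submK _ (U_(rk v) + U_(rk v)) m); last first.
  apply/mnm_lepP => i; rewrite -(enum_valK i) mnmDE !mnm1_rk.
  by have [<-|_] := eqVneq v.
rewrite !mpolyXD; apply: (JM); rewrite -!/(x _).
(* Modulo the differences, a square becomes an edge product, which is in [NI]. *)
have -> : x v * x v = x v * (x v - x (s v)) + x v * x (s v) by ring.
apply: JD; first by apply: JM; apply: diff_foldable.
apply: NI_foldable; have [/edge_mem_NI //|nvX] := boolP (v \in X).
by rewrite mulrC -{2}(sK v); apply: edge_mem_NI; rewrite sX.
Qed.

(** The socle of K[x_v : v in X]/(x_v^2) is spanned by the product of all the variables. *)
Lemma whisker_socle : socle_dim1 J M.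
Proof.
pose g : S := 'X_[mset X].
have fg : fold g = g.
  rewrite /fold /g msubstX [RHS]mpolyXE_id; apply: eq_bigr => i _.
  rewrite -(enum_valK i) msetE enum_rankK /rho.
  by case: (_ \in X); rewrite // !expr0.
exists g; split.
- rewrite foldableP fg monoX => /existsP[v]; rewrite msetE.
  by case: (_ \in X).
- have iJ := foldable_is_ideal.
  move=> y; apply: (@ideal_of_sub _ (fun y => J (y * g))).
    case: iJ => J0 JD JM; split.
    + by rewrite mul0r.
    + by move=> a b Ha Hb; rewrite mulrDl; apply: JD.
    + by move=> r a Ha; rewrite -mulrA; apply: JM.
  move=> _ /mapP[v _ ->]; rewrite foldableP rmorphM /= fg fold_x /xv -mpolyXD.
  apply/monoX/existsP; exists (rho v).
  by rewrite mnmDE mnm1_rk eqxx msetE rhoX.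
move=> h Hh; exists ((fold h)@_(mset X)); rewrite foldableP linearB linearZ /= fg.
move=> m; rewrite mcoeffB mcoeffZ mcoeffX.
have [<-|ne] := eqVneq (mset X) m; first by rewrite mulr1 subrr eqxx.
rewrite mulr0 subr0 => nz; apply: contraT => /existsPn sq.
case/eqP: ne; apply/mnmP => i; rewrite -(enum_valK i) msetE.
set v := enum_val i; have := sq v; rewrite -leqNgt leq_eqVlt ltnS leqn0.
have [vX|nvX] := boolP (v \in X); last first.
  have := nz; rewrite -kill_fold mcoeff_kill; case: ifP; rewrite ?eqxx //.
  move/negbT; rewrite meets_ranks => /exists_inPn /(_ v); rewrite inE nvX.
  by rewrite -leqNgt leqn0 => /(_ isT)/eqP ->.
(* If a squarefree [m] occurring in [fold h] missed [v] in [X], multiplying it by [x v] would keep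
   it squarefree, against the socle condition. *)
have := Hh (x v) (hmax_xv K v); rewrite foldableP rmorphM /= fold_x /rho vX.
move=> /mono_colon /(_ m nz) /existsP[w]; rewrite mnmDE mnm1_rk.
have [<-|_] := eqVneq v w; last by move=> H; have := sq w; rewrite H.
by rewrite add1n ltnS => mv /orP[/eqP->//|/eqP E]; rewrite E in mv.
Qed.

Lemma whisker_gorenstein : gorenstein I M.
Proof.
exists (#|T| - #|X|)%N, edge_diffs.
have szd : size edge_diffs = (#|T| - #|X|)%N by rewrite size_map -cardE card_cores addnK.
have Md : seq_in M edge_diffs.
  move=> i lti; have /mapP[v _ ->] : edge_diffs`_i \in edge_diffs by apply: mem_nth.
  by apply: ideal_sub; [apply: ideal_of_is_ideal|apply: hmax_xv..].
have [H1 H2 H3] := NI_cm_witness cores_minimal_dominating cores_card_min szd Md wreg_edge_diffs.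
by split=> //; split=> //; apply: whisker_socle.
Qed.

End Whisker.

Lemma gorenstein_cm (K : fieldType) (R : comAlgType K) (I M : R -> Prop) :
  gorenstein I M -> cohen_macaulay I M.
Proof. by move=> [d [fs [? ? _ _ _]]]; exists d. Qed.

(** * The four-cycle *)

Section FourVariables.
Variables (K : fieldType) (N : nat) (i0 i1 i2 i3 : 'I_N).
Local Notation S := {mpoly K[N]}.
Local Notation mnm := 'X_{1..N}.
Hypothesis uniq_i : uniq [:: i0; i1; i2; i3].
Hypothesis all_i : forall i, i \in [:: i0; i1; i2; i3].

(** Squarefree monomial ideals in four variables, encoded by Boolean functions of the support so
    that splittings are settled by evaluation. *)
Definition four_mnm (B : bool -> bool -> bool -> bool -> bool) : pred mnm :=
  fun m => B (0 < m i0)%N (0 < m i1)%N (0 < m i2)%N (0 < m i3)%N.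

Definition monotone4 (B : bool -> bool -> bool -> bool -> bool) :=
  forall a b c d a' b' c' d', B a b c d -> B (a || a') (b || b') (c || c') (d || d').

Lemma upset_four B : monotone4 B -> upset (four_mnm B).
Proof. by move=> mB m m'; rewrite /four_mnm !mnmDE !addn_gt0; apply: mB. Qed.

Lemma four_neq : ((i0 == i1) = false) * ((i0 == i2) = false) * ((i0 == i3) = false) *
  ((i1 == i2) = false) * ((i1 == i3) = false) * ((i2 == i3) = false) *
  ((i1 == i0) = false) * ((i2 == i0) = false) * ((i3 == i0) = false) *
  ((i2 == i1) = false) * ((i3 == i1) = false) * ((i3 == i2) = false).
Proof.
move: uniq_i; rewrite /= !inE !negb_or -!andbA.
case/and5P => /negbTE n1 /negbTE n2 /negbTE n3 /negbTE n4 /and3P[/negbTE n5 /negbTE n6 _].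
by rewrite n1 n2 n3 n4 n5 n6 [i1 == _]eq_sym n1 [i2 == i0]eq_sym n2 [i3 == i0]eq_sym n3
  [i2 == i1]eq_sym n4 [i3 == i1]eq_sym n5 [i3 == i2]eq_sym n6.
Qed.

(** In this encoding the sum joins the variable to [B] by disjunction and the colon sets it to true.
    The default of [nth] is never reached, as [i] is one of the four. *)
Lemma wreg_four B i (fs : seq S) : monotone4 B ->
  wreg (mono (four_mnm (fun a b c d => B a b c d ||
    (nth true [:: a; b; c; d] (index i [:: i0; i1; i2; i3]))))) fs ->
  wreg (mono (four_mnm (fun a b c d => B (a || (i == i0)) (b || (i == i1))
    (c || (i == i2)) (d || (i == i3))))) fs ->
  wreg (mono (four_mnm B)) fs.
Proof.
move=> mB H1 H2; apply: (wreg_mono_mid (i := i)); first exact: upset_four.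
  apply: wreg_ext H1; apply: mono_ext => m; rewrite /four_mnm; congr (_ || _).
  have := all_i i; rewrite !inE => /or4P[] /eqP-> /=;
  by rewrite ?eqxx ?four_neq.
apply: wreg_ext H2; apply: mono_ext => m; rewrite /four_mnm.
by rewrite !mnmDE !addn_gt0 !mnm1E !lt0b ![_ || (_ < _)%N]orbC.
Qed.

(** Modulo the first two variables [f1] becomes ['X_j2 + 'X_j3]; replacing ['X_j3] by [- 'X_j2] then
    turns [f2] into minus a nonzero square in a domain. *)
Lemma wreg_two j0 j1 j2 j3 (f1 f2 : S) : uniq [:: j0; j1; j2; j3] ->
  f1 = 'X_j0 + 'X_j1 + 'X_j2 + 'X_j3 ->
  f2 = 'X_j0 * ('X_j1 + 'X_j2 + 'X_j3) + 'X_j1 * ('X_j2 + 'X_j3) + 'X_j2 * 'X_j3 ->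
  wreg (mono (meets [set j0; j1])) [:: f1; f2].
Proof.
move=> /= uj E1 E2; move: uj; rewrite !inE !negb_or -!andbA.
case/and5P => /negbTE n1 /negbTE n2 /negbTE n3 /negbTE n4 /and3P[/negbTE n5 /negbTE n6 _].
set D := [set j0; j1].
have iD : is_ideal (mono (meets D) : S -> Prop).
  by apply: mono_is_ideal; apply: upset_meets.
pose h i : S := if i \in D then 0 else if i == j3 then - 'X_j2 else 'X_i.
have D0 : j0 \in D by rewrite !inE eqxx.
have D1 : j1 \in D by rewrite !inE eqxx orbT.
have nD2 : (j2 \in D) = false by rewrite !inE !(eq_sym j2) n2 n4.
have nD3 : (j3 \in D) = false by rewrite !inE !(eq_sym j3) n3 n5.
have h0 : h j0 = 0 by rewrite /h D0.
have h1 : h j1 = 0 by rewrite /h D1.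
have h2 : h j2 = 'X_j2 by rewrite /h nD2 n6.
have h3 : h j3 = - 'X_j2 by rewrite /h nD3 eqxx.
have nzX (i : 'I_N) : 'X_i != 0 :> S.
  by apply/eqP => /(congr1 (mcoeff U_(i))); rewrite mcoeffX mcoeff0 eqxx => /eqP;
      rewrite oner_eq0.
have kf1 : kill D f1 = 'X_j2 + 'X_j3.
  rewrite E1 !rmorphD /= /kill !msubstXU D0 D1 nD2 nD3; by ring.
split.
  apply: (@nzd_mod_ext _ (fun p => kill D p = 0)); first by move=> p; rewrite pvarP.
  apply: ker_nzd.
  rewrite /= kf1; apply/eqP => /(congr1 (mcoeff U_(j2))).
  by rewrite mcoeffD !mcoeffX mcoeff0 eqxx eq_mnm1 eq_sym n6 addr0 => /eqP; rewrite oner_eq0.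
split=> //; have iP := iplus_is_ideal f1 iD.
have hf1 : msubst h f1 = 0 by rewrite E1 !rmorphD /= !msubstXU h0 h1 h2 h3; ring.
have hf2 : msubst h f2 = - ('X_j2 * 'X_j2).
  rewrite E2 !(rmorphD, rmorphM) /=.
  by rewrite !msubstXU h0 h1 h2 h3; ring.
apply: (@nzd_mod_ext _ (fun p => msubst h p = 0)); last first.
  apply: ker_nzd.
  by rewrite /= hf2 oppr_eq0 mulf_neq0.
move=> p; split=> [Hp|[b Hb]].
  rewrite -[p]subr0 -Hp; apply: msubst_mod => // i; rewrite /h.
  have HD j : j \in D -> iplus (mono (meets D)) f1 'X_j.
    by move=> jD; apply: iplus_sub; apply/pvarXU.
  case: ifP => [iD'|_]; first by rewrite subr0; apply: HD.
  case: eqP => [->|_]; last by rewrite subrr; case: iP.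
  have -> : 'X_j3 - - 'X_j2 = f1 - 'X_j0 - 'X_j1 by rewrite E1; ring.
  apply: (ideal_sub iP); last exact: HD.
  by apply: (ideal_sub iP); [apply: iplus_gen|apply: HD].
rewrite -[p](subrK (b * f1)) rmorphD rmorphM /= hf1 mulr0 addr0.
have [iK _ _] := ker_prime (msubst h).
by apply: (pvar_sub iK) Hb => i iiD; rewrite /= msubstXU /h iiD.
Qed.

(** The closed neighborhoods of the four-cycle are the four sets of three vertices. *)
Definition triples a b c d := [|| a && b && c, a && b && d, a && c && d | b && c && d].

Definition sym1 : S := 'X_i0 + 'X_i1 + 'X_i2 + 'X_i3.
Definition sym2 : S :=
  'X_i0 * ('X_i1 + 'X_i2 + 'X_i3) + 'X_i1 * ('X_i2 + 'X_i3) + 'X_i2 * 'X_i3.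

Lemma wreg_leaf B j0 j1 j2 j3 : uniq [:: j0; j1; j2; j3] ->
  sym1 = 'X_j0 + 'X_j1 + 'X_j2 + 'X_j3 ->
  sym2 = 'X_j0 * ('X_j1 + 'X_j2 + 'X_j3) + 'X_j1 * ('X_j2 + 'X_j3) + 'X_j2 * 'X_j3 ->
  (forall m : mnm, four_mnm B m = (0 < m j0)%N || (0 < m j1)%N) ->
  wreg (mono (four_mnm B)) [:: sym1; sym2].
Proof.
move=> uj E1 E2 HB.
apply: wreg_ext (wreg_two uj E1 E2); apply: mono_ext => m; rewrite HB.
apply/existsP/orP => [[i /andP[]]|[mi|mi]].
- by rewrite !inE => /orP[] /eqP-> ->; [left|right].
- by exists j0; rewrite !inE eqxx.
- by exists j1; rewrite !inE eqxx orbT.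
Qed.

Local Ltac leaf j0 j1 j2 j3 := apply: (@wreg_leaf _ j0 j1 j2 j3);
  [ by rewrite /= !inE !four_neq | by rewrite /sym1; ring | by rewrite /sym2; ring
  | let m := fresh in move=> m; rewrite /four_mnm /triples /= ?eqxx ?four_neq;
    do ![case: (0 < _)%N => //] ].
Local Ltac split_at i := apply: (@wreg_four _ i);
  [ by do 4!case; move=> ? ? ? ?; rewrite /triples /= ?eqxx ?four_neq //= ?orbT
  | | ].

(** Repeated splitting ends in ideals generated by two of the four variables, where [wreg_leaf]
    applies. *)
Lemma wreg_triples : wreg (mono (four_mnm triples)) [:: sym1; sym2].
Proof.
split_at i0.
  split_at i1; first leaf i0 i1 i2 i3.
  by split_at i2; [leaf i0 i2 i1 i3|leaf i0 i3 i1 i2].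
split_at i1; last leaf i2 i3 i0 i1.
by split_at i2; [leaf i1 i2 i0 i3|leaf i1 i3 i0 i2].
Qed.

End FourVariables.

(** * The neighborhood ideal of the four-cycle *)

Section FourCycle.
Variables (K : fieldType) (T : finType) (e : rel T).
Local Notation I := (@NI T e K).
Local Notation M := (@hmax T K).
Local Notation rk := (@enum_rank T).
Variables (f : T -> 'I_4) (g : 'I_4 -> T).
Hypotheses (fK : cancel f g) (gK : cancel g f).
Hypothesis eE : forall u v, e u v = C4_adj (f u) (f v).

Let o0 : 'I_4 := @Ordinal 4 0 isT.
Let o1 : 'I_4 := @Ordinal 4 1 isT.
Let o2 : 'I_4 := @Ordinal 4 2 isT.
Let o3 : 'I_4 := @Ordinal 4 3 isT.

Lemma ord4P (P : 'I_4 -> Prop) : P o0 -> P o1 -> P o2 -> P o3 -> forall j, P j.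
Proof.
move=> P0 P1 P2 P3 [[|[|[|[|//]]]] lt];
by [rewrite (_ : Ordinal lt = o0)//; apply: val_inj
   |rewrite (_ : Ordinal lt = o1)//; apply: val_inj
   |rewrite (_ : Ordinal lt = o2)//; apply: val_inj
   |rewrite (_ : Ordinal lt = o3)//; apply: val_inj].
Qed.

Lemma cnbhd4 j k : (g k \in cnbhd e (g j)) = (k == j) || C4_adj j k.
Proof. by rewrite inE eE !gK (can_eq gK). Qed.

Let i0 := rk (g o0).
Let i1 := rk (g o1).
Let i2 := rk (g o2).
Let i3 := rk (g o3).

Lemma uniq_rk4 : uniq [:: i0; i1; i2; i3].
Proof. by rewrite /= !inE /i0 /i1 /i2 /i3 !(inj_eq enum_rank_inj) !(can_eq gK). Qed.

Lemma all_rk4 i : i \in [:: i0; i1; i2; i3].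
Proof.
rewrite -(enum_valK i) -(fK (enum_val i)).
by apply: (@ord4P (fun j => rk (g j) \in _)); rewrite !inE eqxx ?orbT.
Qed.

Lemma covers4 m : covers e m = four_mnm i0 i1 i2 i3 triples m.
Proof.
rewrite /four_mnm; apply/existsP/idP => [[v]|].
  rewrite -(fK v) => /forall_inP H.
  have H' k : (k == f v) || C4_adj (f v) k -> (0 < m (rk (g k)))%N.
    by move=> Hk; apply: H; rewrite cnbhd4.
  rewrite /triples /i0 /i1 /i2 /i3.
  move: (f v) (H' o0) (H' o1) (H' o2) (H' o3); elim/ord4P => H0 H1 H2 H3.
  - by rewrite (H0 isT) (H1 isT) (H3 isT) ?orbT.
  - by rewrite (H0 isT) (H1 isT) (H2 isT) ?orbT.
  - by rewrite (H1 isT) (H2 isT) (H3 isT) ?orbT.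
  - by rewrite (H0 isT) (H2 isT) (H3 isT) ?orbT.
have H j (P : 'I_4 -> bool) : (forall k, P k -> (0 < m (rk (g k)))%N) ->
    (forall k, (k == j) || C4_adj j k -> P k) ->
    exists v, [forall w in cnbhd e v, (0 < m (rk w))%N].
  move=> HP Hj; exists (g j); apply/forall_inP => w.
  by rewrite -(fK w) cnbhd4 => /Hj /HP.
case/or4P => /andP[/andP[m1 m2] m3].
- by apply: (H o1 (fun k => k != o3)); elim/ord4P.
- by apply: (H o0 (fun k => k != o2)); elim/ord4P.
- by apply: (H o3 (fun k => k != o1)); elim/ord4P.
- by apply: (H o2 (fun k => k != o0)); elim/ord4P.
Qed.

Lemma dominating4_ge D : dominating e D -> (2 <= #|D|)%N.
Proof.
move=> /forallP dD; rewrite ltnNge; apply/negP => /card_le1_eqP H.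
have /set0Pn[u /setIP[uD _]] := dD (g o0).
(* A single vertex misses the closed neighborhood of the opposite one. *)
pose opp (j : 'I_4) : 'I_4 := inord ((j + 2) %% 4).
have /set0Pn[v /setIP[vD]] := dD (g (opp (f u))).
rewrite (H _ _ uD vD) -{1}(fK u) cnbhd4.
suff -> : (f u == opp (f u)) || C4_adj (opp (f u)) (f u) = false by [].
by apply: (@ord4P (fun j => (j == opp j) || C4_adj (opp j) j = false));
  rewrite /C4_adj -val_eqE /= inordK.
Qed.

Lemma dominating4 : minimal_dominating e [set g o0; g o1].
Proof.
apply/andP; split.
  apply/forallP => v; apply/set0Pn; rewrite -(fK v).
  have H j k : (k == j) || C4_adj j k -> (k == o0) || (k == o1) ->
      exists w, w \in [set g o0; g o1] :&: cnbhd e (g j).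
    by move=> H1 H2; exists (g k); rewrite inE cnbhd4 H1 !inE !(can_eq gK) H2.
  by apply: (@ord4P (fun j => exists w, w \in _ :&: cnbhd e (g j)));
    [apply: (H _ o0)|apply: (H _ o1)|apply: (H _ o1)|apply: (H _ o0)].
apply/forall_inP => v vD; apply/negP => /dominating4_ge.
by have := cardsD1 v [set g o0; g o1]; rewrite vD cards2 (can_eq gK) /=; lia.
Qed.

Lemma c4_cohen_macaulay : cohen_macaulay I M.
Proof.
have card4 : #|T| = 4 by rewrite (bij_eq_card (Bijective fK gK)) card_ord.
have card2 : #|[set g o0; g o1]| = 2 by rewrite cards2 (can_eq gK).
have [||i||H1 H2 _] := @NI_cm_witness K T e _
  [:: sym1 K i0 i1 i2 i3; sym2 K i0 i1 i2 i3] dominating4.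
- by move=> D' /dominating4_ge; rewrite card2.
- by rewrite /= card2 card4.
- have iM : is_ideal M by apply: ideal_of_is_ideal.
  have Mx j : M 'X_(rk (g j)) by apply: hmax_xv.
  case: (iM) => _ HD _; move: i => [|[|//]] _; rewrite /= /sym1 /sym2.
    exact: HD (HD _ _ (HD _ _ (Mx _) (Mx _)) (Mx _)) (Mx _).
  have MM j p : M ('X_(rk (g j)) * p) by apply: ideal_mulr (Mx j).
  exact: HD (HD _ _ (MM _ _) (MM _ _)) (MM _ _).
- apply: wreg_ext (wreg_triples K uniq_rk4 all_rk4) => p.
  by rewrite NI_mono; apply: mono_ext => m; rewrite covers4.
by exists (#|T| - #|[set g o0; g o1]|)%N.
Qed.

End FourCycle.

(** * The six equivalent conditions *)

Theorem theorem4p4 (K : fieldType) (T : finType) (e : rel T) (n : nat) :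
  simple_graph e -> connected_graph e -> very_well_covered e ->
  #|T| = (2 * n)%N -> (2 <= n)%N ->
  let I := @NI T e K in
  let M := @hmax T K in
  [<-> cohen_macaulay I M;
       well_dominated e;
       is_C4 e \/ whisker_graph e;
       is_C4 e \/ complete_intersection I;
       is_C4 e \/ gorenstein I M;
       gamma e = alpha e /\ alpha e = n].
Proof.
move=> [e_sym e_irr] e_conn [e_nbr e_vwc] cardT n_ge2 I M.
have wd_gamma : well_dominated e -> gamma e = alpha e /\ alpha e = n.
  exact: well_dominated_gamma.
have gamma_wh : gamma e = alpha e /\ alpha e = n -> is_C4 e \/ whisker_graph e.
  move=> [Eg Ea]; apply: (@C4_or_whisker T e n) => // D /gamma_le.
  by rewrite Eg Ea.
have wh_ci : whisker_graph e -> complete_intersection I.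
  case/(whisker_pairing e_sym e_conn cardT n_ge2) => X [s [sK sX s_nb s_leaf]].
  exact: whisker_complete_intersection sK sX s_nb s_leaf.
have wh_gor : whisker_graph e -> gorenstein I M.
  case/(whisker_pairing e_sym e_conn cardT n_ge2) => X [s [sK sX s_nb s_leaf]].
  exact: whisker_gorenstein sK sX s_nb s_leaf.
have c4_cm : is_C4 e -> cohen_macaulay I M.
  move=> [f [[g fK gK] eE]]; exact: c4_cohen_macaulay fK gK eE.
split; first exact: cm_well_dominated.
split; first by move/wd_gamma/gamma_wh.
split; first by case=> [|/wh_ci]; [left|right].
split.
  (* A complete intersection reaches the Gorenstein property through the combinatorics: the graph is
     well-dominated, hence a four-cycle or a whisker graph. *)
  case=> [|/ci_well_dominated/wd_gamma/gamma_wh[|/wh_gor]]; by [left|right].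
split.
  by case=> [/c4_cm|/gorenstein_cm] /cm_well_dominated/wd_gamma.
by case/gamma_wh => [/c4_cm|/wh_gor/gorenstein_cm].
Qed.
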